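(* For all $n\ge 0$, $g\ge 0$, $v,f\ge 1$: $$C_g(n)=\mathrm{Cat}(n)\,B_g(n+1),\qquad C^{v,f}(n)=\mathrm{Cat}(n)\,B^{v,f}(n+1),$$ where $\mathrm{Cat}(n)=\frac{1}{n+1}\binom{2n}{n}$.
   Context: Maps are rooted combinatorial maps $M=(H,\sigma,\alpha)$ ($H$ finite set of half-edges, $\alpha$ fixed-point-free involution, $\sigma$ a permutation, $\langle\sigma,\alpha\rangle$ transitive, a root $r\in H$), counted up to root-preserving isomorphism; vertices, edges, faces are the cycles of $\sigma$, $\alpha$, $\sigma\alpha$ (composition right to left), genus $g$ satisfies $v-e+f=2-2g$. A unicellular map has one face; the map with $H=\emptyset$ counts as unicellular (one vertex). For $S\subseteq H$, $\pi_{|S}$ denotes the permutation of $S$ obtained by deleting from the cycles of $\pi$ the elements not in $S$. A covered map is a pair $(M,S)$ with $S\subseteq H$ stable under $\alpha$ such that $(S,\sigma_{|S},\alpha_{|S})$ is a connecting unicellular map ($\sigma_{|S},\alpha_{|S}$ transitive on $S$, $S$ meets every cycle of $\sigma$ — except $S=\emptyset$ allowed when $M$ has one vertex — and $\sigma_{|S}\alpha_{|S}$ cyclic). $C_g(n)$ is the number of covered maps of genus $g$ with $n$ edges; $C^{v,f}(n)$ the number of covered maps with $n$ edges, $v$ vertices and $f$ faces. $B_g(n)$ is the number of bipartite unicellular maps of genus $g$ with $n$ edges; $B^{v,f}(n)$ the number of bipartite unicellular maps with $n$ edges having $v$ white and $f$ black vertices, for the proper 2-coloring in which the root-vertex is white.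 *)

(* Defs.v *)
From HB Require Import structures.
From mathcomp Require Import all_boot all_fingroup.
Set Implicit Arguments. Unset Strict Implicit. Unset Printing Implicit Defensive.

Section Maps.
Variable T : finType.

(* A map (sigma, alpha, root) on the half-edge set T.  The root is an option:
   it is [None] exactly when T is empty (the empty map). *)
Definition step_rel (f g : T -> T) : rel T := fun u w => (w == f u) || (w == g u).

Definition is_map (s a : {perm T}) (r : option T) : bool :=
  [&& [forall x, (a (a x) == x) && (a x != x)],
      [forall x, forall y, connect (step_rel s a) x y] &
      ((r == None) == (#|T| == 0))].

(* vertices = cycles of sigma, faces = cycles of sigma o alpha (right to left),
   i.e. (alpha * sigma)%g in mathcomp (where (p * q) x = q (p x)).
   The empty map has one vertex and one face. *)
Definition nverts (s : {perm T}) : nat := maxn 1 #|porbits s|.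
Definition nfaces (s a : {perm T}) : nat := maxn 1 #|porbits (a * s)%g|.
Definition nedges : nat := #|T| %/ 2.

Definition has_genus (s a : {perm T}) (g : nat) : bool :=
  nverts s + nfaces s a + g.*2 == nedges + 2.

(* pi_{|S}: first return map of pi to S (identity outside S). *)
Definition restr (f : T -> T) (S : {set T}) (x : T) : T :=
  if x \in S then iter (nth 0 [seq k <- iota 1 #|T| | iter k f x \in S] 0) f x
  else x.

Definition is_cover (s a : {perm T}) (S : {set T}) : bool :=
  [&& [forall x, (x \in S) == (a x \in S)],
      [forall x in S, forall y in S,
         connect (step_rel (restr s S) (restr a S)) x y],
      [forall x, [exists y in S, y \in porbit s x]]
        || ((S == set0) && (nverts s == 1)) &
      [forall x in S, forall y in S,
         fconnect (fun z => restr s S (restr a S z)) x y]].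

Definition iso_map (s a : {perm T}) (r : option T) (s' a' : {perm T}) (r' : option T)
  (phi : {perm T}) : bool :=
  [&& [forall x, phi (s x) == s' (phi x)],
      [forall x, phi (a x) == a' (phi x)] &
      (omap phi r == r')].

Definition nclasses (U : finType) (P : pred U) (R : rel U) : nat :=
  #|[set [set y | P y && R x y] | x in [set x | P x]]|.

Definition MapT := ({perm T} * {perm T} * option T)%type.
Definition CovT := ({perm T} * {perm T} * option T * {set T})%type.

Definition cov_rel : rel CovT := fun X Y =>
  let: (s, a, r, B) := X in let: (s', a', r', B') := Y in
  [exists phi : {perm T}, iso_map s a r s' a' r' phi && (phi @: B == B')].

Definition map_rel : rel MapT := fun X Y =>
  let: (s, a, r) := X in let: (s', a', r') := Y in
  [exists phi : {perm T}, iso_map s a r s' a' r' phi].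

Definition covered_genus (g : nat) : pred CovT := fun X =>
  let: (s, a, r, B) := X in [&& is_map s a r, is_cover s a B & has_genus s a g].

Definition covered_vf (v f : nat) : pred CovT := fun X =>
  let: (s, a, r, B) := X in
  [&& is_map s a r, is_cover s a B, nverts s == v & nfaces s a == f].

(* proper 2-coloring of the vertices: c constant on vertices, each edge joins
   two different colours; true = white *)
Definition proper_col (s a : {perm T}) (c : {ffun T -> bool}) : bool :=
  [forall x, c (s x) == c x] && [forall x, c (a x) != c x].

Definition bip_uni_genus (g : nat) : pred MapT := fun X =>
  let: (s, a, r) := X in
  [&& is_map s a r, nfaces s a == 1, has_genus s a g &
      [exists c : {ffun T -> bool}, proper_col s a c]].

Definition bip_uni_vf (v f : nat) : pred MapT := fun X =>
  let: (s, a, r) := X in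
  [&& is_map s a r, nfaces s a == 1 &
      [exists c : {ffun T -> bool},
        [&& proper_col s a c,
            (if r is Some x0 then c x0 else true),
            #|[set O in porbits s | [exists x in O, c x]]| == v &
            #|[set O in porbits s | [exists x in O, ~~ c x]]| == f]]].

End Maps.

Definition Cg (g n : nat) : nat :=
  nclasses (covered_genus (T := 'I_(n.*2)) g) (@cov_rel _).
Definition Cvf (v f n : nat) : nat :=
  nclasses (covered_vf (T := 'I_(n.*2)) v f) (@cov_rel _).
Definition Bg (g n : nat) : nat :=
  nclasses (bip_uni_genus (T := 'I_(n.*2)) g) (@map_rel _).
Definition Bvf (v f n : nat) : nat :=
  nclasses (bip_uni_vf (T := 'I_(n.*2)) v f) (@map_rel _).

Definition Cat (n : nat) : nat := 'C(n.*2, n) %/ n.+1.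

(* Main.v *)
Require Import Defs.
From mathcomp Require Import all_boot all_fingroup.
From mathcomp Require Import zify.

Set Implicit Arguments.
Unset Strict Implicit.
Unset Printing Implicit Defensive.

(* Both sides are compared with npairs Q m, the number of u in S_m whose cycle
   number and that of its product with a long cycle satisfy Q.

   A bipartite unicellular map with m edges is a long cycle of its 2m half-edges
   together with a matching alpha exchanging even and odd positions, that is, a
   permutation u of the m even ones; white and black vertices are the cycles of u
   and of its product with the long cycle.

   The tour of a submap S is tau = sigma alpha_S, where alpha_S is alpha on S and
   the identity elsewhere, and (M, S) is a covered map exactly when tau is one cycle;
   so covered maps with n edges number C(2n, n) n!.  Insert an extra half-edge x0
   before the root, and let J consist of x0 and, for each edge, the half-edge visited
   second (edge in S) or first (edge not in S) by the tour.  For fixed sigma and alpha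
   this is a bijection from the covers S onto the sets J such that each x <> x0 has
   exactly one of x, alpha x in J, and such that iterating
   (x |-> alpha x if x in J, sigma x otherwise) always leads to x0.  That condition only
   involves sigma outside J, hence is invariant under right multiplication of sigma by
   the permutations of J.  Each coset contains some rho with a single element of J in
   every cycle; the whole map is then its only cover, so rho alpha is one long cycle,
   and the coset { rho p } contributes npairs Q (n+1) out of (n+1)! elements. *)

(** * First returns and cycle counts *)

(** On [A] the map [f] factors through [g], so its image is the image of [g @: A] under the factor
    map [h]. Values in [option U] keep [h] total when no element of [U] is at hand. *)
Lemma leq_card_imset_ker (T U V : finType) (f : T -> U) (g : T -> V) (A : {pred T}) :
  {in A &, forall x y, g x = g y -> f x = f y} -> #|f @: A| <= #|g @: A|.
Proof.
move=> fg; pose h z := if [pick x in A | g x == z] is Some x then Some (f x) else None.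
have Sinj : injective (@Some U) by move=> x y [].
rewrite -(card_imset _ Sinj); apply: leq_trans (leq_imset_card h _).
apply: subset_leq_card; apply/subsetP=> _ /imsetP[_ /imsetP[x Ax ->] ->].
apply/imsetP; exists (g x); first exact: imset_f.
rewrite /h; case: pickP => [y /andP[Ay /eqP gyx]|/(_ x)]; last by rewrite Ax eqxx.
by rewrite (fg _ _ Ay Ax gyx).
Qed.

Lemma eq_card_imset_ker (T U V : finType) (f : T -> U) (g : T -> V) (A : {pred T}) :
  {in A &, forall x y, f x = f y <-> g x = g y} -> #|f @: A| = #|g @: A|.
Proof.
move=> fg; apply/eqP; rewrite eqn_leq.
by rewrite !leq_card_imset_ker // => x y Ax Ay; case: (fg x y Ax Ay).
Qed.

Lemma porbit_fconnect (T : finType) (s : {perm T}) x y :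
  (y \in porbit s x) = fconnect s x y.
Proof.
apply/porbitP/idP => [[i ->]|/iter_findex e]; first by rewrite permX fconnect_iter.
by exists (findex s x y); rewrite permX.
Qed.

Lemma mem_porbit_iter (T : finType) (s : {perm T}) i x : iter i s x \in porbit s x.
Proof. by rewrite porbit_fconnect fconnect_iter. Qed.

Lemma porbit_iterP (T : finType) (s : {perm T}) x y :
  reflect (exists i, iter i s x = y) (y \in porbit s x).
Proof.
apply: (iffP (porbitP _ _ _)) => -[i]; first by rewrite permX => ->; exists i.
by move=> <-; exists i; rewrite permX.
Qed.

Definition unicyclic (T : finType) (s : {perm T}) := #|porbits s| <= 1.

Lemma unicyclicP (T : finType) (s : {perm T}) :
  reflect (forall x y, y \in porbit s x) (unicyclic s).
Proof.
apply: (iffP idP) => [s1 x y|s1].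
  have /eqP -> : porbit s x == porbit s y; last exact: porbit_id.
  apply/eqP; move: s1; rewrite /unicyclic => /card_le1_eqP; apply; exact: imset_f.
apply/card_le1_eqP => _ _ /imsetP[x _ ->] /imsetP[y _ ->].
by apply/eqP; rewrite eq_porbit_mem s1.
Qed.

Section FirstReturn.
Variables (T : finType) (s : {perm T}).

(** Relational form of [restr]: the return takes at least one step, whence [k.+1]. The relation is
    functional, so exhibiting a return time computes [restr]. *)
Definition returns (J : {set T}) x y :=
  exists k, [/\ iter k.+1 s x = y, y \in J & forall i, i < k -> iter i.+1 s x \notin J].

Variable J : {set T}.

Lemma restr_notin x : x \notin J -> restr s J x = x.
Proof. by rewrite /restr => /negbTE ->. Qed.

Lemma returns_uniq x y z : returns J x y -> returns J x z -> y = z.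
Proof.
move=> [k [<- Jk kmin]] [l [<- Jl lmin]].
case: (ltngtP k l) => [/lmin|/kmin|-> //]; last by rewrite Jl.
by rewrite Jk.
Qed.

Lemma restr_returns x : x \in J -> returns J x (restr s J x).
Proof.
move=> Jx; rewrite /restr Jx.
set L := [seq _ <- _ | _].
(* The period of [x] is a return time at most [#|T|], so the list in [restr] is nonempty and its
   default 0 is never read. *)
have ordle : fingraph.order s x <= #|T| by apply: max_card.
have Lne : has (fun k => iter k s x \in J) (iota 1 #|T|).
  apply/hasP; exists (fingraph.order s x).
    by rewrite mem_iota fingraph.order_gt0 /= add1n ltnS.
  by rewrite iter_order //; exact: perm_inj.
have -> : nth 0 L 0 = nth 0 (iota 1 #|T|) (find (fun k => iter k s x \in J) (iota 1 #|T|)).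
  rewrite /L; elim: (iota 1 #|T|) Lne => //= a l IH.
  by case: ifP => //= _; apply: IH.
have lt := Lne; rewrite has_find size_iota in lt.
have := nth_find 0 Lne; rewrite !nth_iota // => Jk.
exists (find (fun k => iter k s x \in J) (iota 1 #|T|)); split=> //.
move=> i ik; have := before_find 0 ik; rewrite nth_iota ?add1n => [-> //|].
exact: ltn_trans ik lt.
Qed.

Lemma restr_returnsE x y : x \in J -> returns J x y -> restr s J x = y.
Proof. by move=> Jx; apply: returns_uniq; exact: restr_returns. Qed.

Lemma restr_step x : x \in J -> s x \in J -> restr s J x = s x.
Proof. by move=> Jx Jsx; apply: restr_returnsE => //; exists 0. Qed.

Lemma restr_in x : (restr s J x \in J) = (x \in J).
Proof.
case: (boolP (x \in J)) => Jx; last by rewrite restr_notin // (negbTE Jx).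
by case: (restr_returns Jx) => k [].
Qed.

Lemma restr_porbit x : restr s J x \in porbit s x.
Proof.
case: (boolP (x \in J)) => Jx; last by rewrite restr_notin // porbit_id.
by case: (restr_returns Jx) => k [<- _ _]; exact: mem_porbit_iter.
Qed.

Lemma iter_restr_in i x : (iter i (restr s J) x \in J) = (x \in J).
Proof. by elim: i => //= i; rewrite restr_in. Qed.

(** Strong induction on [i]: once the first return is removed, the remaining trajectory is strictly
    shorter. *)
Lemma iter_restr i x : x \in J -> iter i s x \in J ->
  exists j, iter j (restr s J) x = iter i s x.
Proof.
elim/ltn_ind: i x => -[|i] IH x Jx Ji; first by exists 0.
have [k [kE Jk kmin]] := restr_returns Jx.
have ki : k <= i by rewrite leqNgt; apply/negP => /kmin; rewrite Ji.
have : iter (i - k) s (restr s J x) = iter i.+1 s x.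
  by rewrite -kE -iterD addnS subnK.
move=> E; have ltik : i - k < i.+1 by lia.
have [||j jE] := IH _ ltik (restr s J x); rewrite ?restr_in ?E //.
by exists j.+1; rewrite iterSr jE.
Qed.

Lemma iter_restr_porbit i x : iter i (restr s J) x \in porbit s x.
Proof.
elim: i => [|i IH] /=; first exact: porbit_id.
by move: IH; rewrite -eq_porbit_mem => /eqP <-; exact: restr_porbit.
Qed.

Lemma restr_fconnect x y : x \in J -> y \in J ->
  fconnect (restr s J) x y = (y \in porbit s x).
Proof.
move=> Jx Jy; apply/idP/porbit_iterP => [/iter_findex <-|[i iE]].
  by apply/porbit_iterP; exact: iter_restr_porbit.
have [||j jE] := @iter_restr i x _ _ => //; first by rewrite iE.
by rewrite -iE -jE fconnect_iter.
Qed.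

(** Two trajectories with the same arrival are run backwards. The start of the shorter one lies on
    the longer one and, unless the lengths agree, is an intermediate point there, hence outside
    [J]. *)
Lemma restr_inj : injective (restr s J).
Proof.
suff W x y k l : returns J x (restr s J x) -> x \in J -> y \in J ->
   iter k.+1 s x = iter l.+1 s y -> (forall i, i < l -> iter i.+1 s y \notin J) ->
   k <= l -> x = y.
  move=> x y E; have := restr_in x; rewrite E restr_in.
  case: (boolP (x \in J)) => Jx Jy; last by move: E; rewrite !restr_notin // Jy.
  have Rx := restr_returns Jx; have Ry := restr_returns Jy.
  have [k [kE _ kmin]] := Rx; have [l [lE _ lmin]] := Ry.
  have Ekl : iter k.+1 s x = iter l.+1 s y by rewrite kE lE.
  case: (leqP k l) => kl; first exact: W Rx Jx Jy Ekl lmin kl.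
  by symmetry; apply: W Ry Jy Jx (esym Ekl) kmin (ltnW kl).
move=> Rx Jx Jy E lmin kl.
have xE : x = iter (l - k) s y.
  apply: (@perm_inj _ (s ^+ k.+1)%g); rewrite !permX.
  by rewrite E -iterD addSn addnC subnK.
case: (posnP (l - k)) => [lk0|lk]; first by rewrite xE lk0.
have : iter (l - k).-1.+1 s y \notin J by apply: lmin; lia.
by rewrite prednK // -xE Jx.
Qed.

(** In the coordinates [e] of [J], [u] is the first-return map; its cycles are the traces on [J] of
    the cycles of [s] that meet [J]. *)
Lemma card_porbits_return (Y : finType) (e : Y -> T) (u : {perm Y}) :
  injective e -> (forall x, (x \in J) = (x \in codom e)) ->
  (forall y, restr s J (e y) = e (u y)) ->
  #|[set O in porbits s | [exists x in O, x \in J]]| = #|porbits u|.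
Proof.
move=> e_inj eJ eu.
have Je y : e y \in J by rewrite eJ codom_f.
have eui i y : iter i (restr s J) (e y) = e (iter i u y).
  by elim: i => //= i ->; rewrite eu.
have -> : [set O in porbits s | [exists x in O, x \in J]] = [set porbit s (e y) | y : Y].
  apply/setP=> O; rewrite inE; apply/andP/imsetP => [[/imsetP[x _ ->]]|[y _ ->]].
    case/existsP=> z /andP[xz]; rewrite eJ => /codomP[y zE]; exists y => //.
    by apply/eqP; rewrite eq_porbit_mem -zE porbit_sym.
  by split; [exact: imset_f|apply/existsP; exists (e y); rewrite porbit_id Je].
apply: (@eq_card_imset_ker _ _ _ _ _ predT) => x y _ _.
split=> /eqP; rewrite !eq_porbit_mem -?(restr_fconnect (Je _) (Je _)).
  move=> /iter_findex; rewrite eui => /e_inj <-; apply/eqP.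
  by rewrite eq_porbit_mem mem_porbit_iter.
move=> /porbit_iterP [i <-]; apply/eqP; rewrite eq_porbit_mem -eui.
exact: iter_restr_porbit.
Qed.

Lemma card_porbits_return_all (Y : finType) (e : Y -> T) (u : {perm Y}) :
  injective e -> (forall x, (x \in J) = (x \in codom e)) ->
  (forall y, restr s J (e y) = e (u y)) ->
  (forall x, exists2 y, y \in porbit s x & y \in J) ->
  #|porbits s| = #|porbits u|.
Proof.
move=> e_inj eJ eu meet; rewrite -(card_porbits_return e_inj eJ eu).
congr #|pred_of_set _|; apply/setP=> O; rewrite inE.
apply: esym; apply/andb_idr => /imsetP[x _ ->].
by have [y xy Jy] := meet x; apply/existsP; exists y; rewrite xy.
Qed.

End FirstReturn.

(** [p] acts first and only on [J]: after this single use the trajectory follows [s] until it is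
    back in [J]. *)
Lemma restr_mul (T : finType) (s p : {perm T}) (J : {set T}) x :
  perm_on J p -> x \in J -> restr (p * s)%g J x = restr s J (p x).
Proof.
move=> pJ Jx; have Jpx : p x \in J by rewrite (perm_closed x pJ).
apply: restr_returnsE => //.
have [k [kE Jk kmin]] := restr_returns s Jpx.
have E i : i <= k -> iter i.+1 (p * s)%g x = iter i.+1 s (p x).
  elim: i => [_|i IH ik]; first by rewrite /= permM.
  by rewrite iterS IH 1?ltnW // permM (out_perm pJ) ?kmin // -iterS.
by exists k; split=> [|//|i ik]; rewrite E // ?kmin // ltnW.
Qed.

(** A cycle of [p * s] avoiding [J] never feels [p], so it would be a cycle of [s] avoiding [J]. *)
Lemma porbit_meet_mul (T : finType) (s p : {perm T}) (J : {set T}) :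
  perm_on J p -> (forall x, exists2 y, y \in porbit s x & y \in J) ->
  forall x, exists2 y, y \in porbit (p * s)%g x & y \in J.
Proof.
move=> pJ meet x.
case: (boolP [exists y in porbit (p * s)%g x, y \in J]) => [/existsP[y /andP[]]|no].
  by move=> ? ?; exists y.
have noJ i : iter i (p * s)%g x \notin J.
  apply: contra no => Ji; apply/existsP; exists (iter i (p * s)%g x).
  by rewrite mem_porbit_iter.
have E i : iter i (p * s)%g x = iter i s x.
  by elim: i => //= i <-; rewrite permM (out_perm pJ).
have [_ /porbit_iterP[i <-]] := meet x; by rewrite -E (negbTE (noJ i)).
Qed.

Lemma card_porbits_intertwine (T Y : finType) (s : {perm T}) (u : {perm Y}) (e : Y -> T) :
  bijective e -> (forall y, s (e y) = e (u y)) -> #|porbits s| = #|porbits u|.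
Proof.
move=> e_bij eu; apply: (@card_porbits_return_all _ _ setT _ e).
- exact: bij_inj.
- by move=> x; rewrite inE; case: e_bij => d _ dK; rewrite -(dK x) codom_f.
- by move=> y; rewrite restr_step ?inE // eu.
- by move=> x; exists x; rewrite ?porbit_id ?inE.
Qed.

Lemma card_porbits_mulC (T : finType) (u v : {perm T}) :
  #|porbits (u * v)%g| = #|porbits (v * u)%g|.
Proof.
apply: (@card_porbits_intertwine _ _ _ _ v).
  by exists v^-1%g => x; rewrite ?permK ?permKV.
by move=> y; rewrite !permM.
Qed.

Lemma findex_step (T : finType) (t : {perm T}) x0 x : fconnect t x0 x -> t x != x0 ->
  findex t x0 (t x) = (findex t x0 x).+1.
Proof.
move=> cx nx; have : (findex t x0 x).+1 <= fingraph.order t x0 := findex_max cx.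
rewrite leq_eqVlt => /predU1P[E|lt].
  case/eqP: nx; rewrite -[RHS](iter_order (@perm_inj _ t)) -E /=.
  by rewrite iter_findex.
by rewrite -{1}(iter_findex cx) -iterS findex_iter.
Qed.

Lemma findex_last (T : finType) (t : {perm T}) x0 x : fconnect t x0 x -> t x = x0 ->
  (findex t x0 x).+1 = fingraph.order t x0.
Proof.
move=> cx tx; have : (findex t x0 x).+1 <= fingraph.order t x0 := findex_max cx.
rewrite leq_eqVlt => /predU1P[//|/findex_iter].
by rewrite iterS iter_findex // tx findex0.
Qed.

(** * Permutations supported on a subset *)

Section Extension.
Variables (T Y : finType) (e : Y -> T) (e_inj : injective e).

Definition ext_fun (u : {perm Y}) x := if [pick y | e y == x] is Some y then e (u y) else x.

Lemma ext_funE u y : ext_fun u (e y) = e (u y).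
Proof.
by rewrite /ext_fun; case: pickP => [z /eqP/e_inj -> //|/(_ y)]; rewrite eqxx.
Qed.

Lemma ext_fun_out u x : x \notin codom e -> ext_fun u x = x.
Proof.
rewrite /ext_fun; case: pickP => // y /eqP <-; by rewrite codom_f.
Qed.

Lemma ext_fun_inj u : injective (ext_fun u).
Proof.
move=> x x'; case: (boolP (x \in codom e)) => [/codomP[y ->]|xe];
  case: (boolP (x' \in codom e)) => [/codomP[y' ->]|xe'];
  rewrite ?ext_funE ?(ext_fun_out _ xe) ?(ext_fun_out _ xe') //.
- by move=> /e_inj/perm_inj ->.
- by move=> E; rewrite -E codom_f in xe'.
- by move=> E; rewrite E codom_f in xe.
Qed.

Definition ext u : {perm T} := perm (@ext_fun_inj u).

Lemma extE u y : ext u (e y) = e (u y).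
Proof. by rewrite permE ext_funE. Qed.

Lemma ext_out u x : x \notin codom e -> ext u x = x.
Proof. by rewrite permE; exact: ext_fun_out. Qed.

Lemma ext_inj : injective ext.
Proof. by move=> u v E; apply/permP=> y; apply: e_inj; rewrite -!extE E. Qed.

Lemma ext_perm_on u : perm_on [set x in codom e] (ext u).
Proof.
by apply/subsetP=> x; rewrite !inE; apply: contraR => /(ext_out u) ->.
Qed.

Lemma extM u v : ext (u * v)%g = (ext u * ext v)%g.
Proof.
apply/permP=> x; rewrite permM; case: (boolP (x \in codom e)) => [/codomP[y ->]|xe].
  by rewrite !extE permM.
by rewrite !ext_out // ext_out.
Qed.

(** By counting: [ext] is injective, and the permutations of [Y] are as many as those supported on
    the image of [e]. *)
Lemma perm_on_ext p : perm_on [set x in codom e] p -> exists u, p = ext u.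
Proof.
move=> pe; suff : p \in [set ext u | u : {perm Y}] by case/imsetP=> u _ ->; exists u.
suff -> : [set ext u | u : {perm Y}] = [set q | perm_on [set x in codom e] q] by rewrite inE.
apply/eqP; rewrite eqEcard; apply/andP; split.
  by apply/subsetP=> _ /imsetP[u _ ->]; rewrite inE ext_perm_on.
rewrite [leqLHS](eq_card (B := perm_on [set x in codom e])) => [|q]; last by rewrite inE.
rewrite card_perm card_imset; last exact: ext_inj.
rewrite [#|[set _ in _]|]cardsE card_codom //.
have := card_perm [set: Y]; rewrite cardsT => <-.
by apply: subset_leq_card; apply/subsetP.
Qed.

End Extension.

Definition rot_ord m : {perm 'I_m} := perm (@ordS_inj m).

(** [e] lists [J] in the order in which [t] visits it, so the first return becomes the rotation of
    the indices. *)
Lemma unicyclic_enum (T : finType) (t : {perm T}) (J : {set T}) m :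
  unicyclic t -> #|J| = m -> 0 < m ->
  exists e : 'I_m -> T, [/\ injective e, forall x, (x \in J) = (x \in codom e) &
    forall i, restr t J (e i) = e (rot_ord m i)].
Proof.
move=> /unicyclicP t1 Jm m0.
have /card_gt0P[j0 Jj0] : 0 < #|J| by rewrite Jm.
pose h := restr t J.
have hJ x : (x \in J) = fconnect h j0 x.
  case: (boolP (x \in J)) => Jx; first by rewrite restr_fconnect ?t1.
  apply/esym/negbTE; apply: contra Jx => /iter_findex <-.
  by rewrite iter_restr_in.
have hm : fingraph.order h j0 = m by rewrite -Jm; apply: eq_card => x; rewrite hJ.
have h_inj := @restr_inj _ t J.
exists (fun i => iter i h j0); split.
- move=> i j /= E; apply: val_inj.
  have fi (k : 'I_m) : findex h j0 (iter k h j0) = k by rewrite findex_iter ?hm.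
  by rewrite /= -(fi i) E fi.
- move=> x; rewrite hJ; apply/idP/codomP => [hx|[i ->]]; last exact: fconnect_iter.
  have lt := findex_max hx; rewrite hm in lt.
  by exists (Ordinal lt); rewrite /= iter_findex.
- move=> i; rewrite permE /= -/h -iterS.
  have := ltn_ord i; rewrite leq_eqVlt => /predU1P[E|lt]; last by rewrite modn_small.
  by rewrite E modnn -{1}hm iter_order.
Qed.

Definition npairs (Q : nat -> nat -> bool) m :=
  #|[set u : {perm 'I_m} | Q #|porbits u| #|porbits (u * rot_ord m)%g| ]|.

(** Each cycle of [r] holds exactly one point of [J], so the first return of [p * r] to [J] is [p]
    itself, while that of [p * t] is [p] followed by the long cycle that [t] induces on [J]. *)
Lemma card_perm_on_porbits (T : finType) (r t : {perm T}) (J : {set T}) (Q : nat -> nat -> bool) :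
  (forall x, exists2 y, y \in porbit r x & y \in J) -> {in J, forall x, restr r J x = x} ->
  unicyclic t -> 0 < #|J| ->
  #|[set p | perm_on J p && Q #|porbits (p * r)%g| #|porbits (p * t)%g| ]| = npairs Q #|J|.
Proof.
move=> rJ r1 t1 J0.
have [m Jm] : exists m, #|J| = m by exists #|J|.
have m0 := J0; rewrite Jm in m0 *.
have [e [e_inj eJ et]] := unicyclic_enum t1 Jm m0.
have eJ' : J = [set x in codom e] by apply/setP=> x; rewrite inE eJ.
have tJ x : exists2 y, y \in porbit t x & y \in J.
  by move: m0; rewrite -Jm => /card_gt0P[y Jy]; exists y => //; apply/unicyclicP.
have extJ u : perm_on J (ext e_inj u) by rewrite eJ' ext_perm_on.
have Je y : e y \in J by rewrite eJ codom_f.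
rewrite /npairs -(card_imset _ (@ext_inj _ _ _ e_inj)); congr #|pred_of_set _|.
have E u : #|porbits (ext e_inj u * r)%g| = #|porbits u|.
  apply: (@card_porbits_return_all _ _ J _ e) => // [y|].
    by rewrite restr_mul // extE r1.
  exact: porbit_meet_mul.
have F u : #|porbits (ext e_inj u * t)%g| = #|porbits (u * rot_ord m)%g|.
  apply: (@card_porbits_return_all _ _ J _ e) => // [y|].
    by rewrite restr_mul // extE et permM.
  exact: porbit_meet_mul.
apply/setP=> p; rewrite inE; apply/andP/imsetP => [[pJ]|[u]].
  rewrite eJ' in pJ; have [u ->] := perm_on_ext e_inj pJ.
  by rewrite E F => Qu; exists u; rewrite ?inE.
by rewrite inE => Qu ->; rewrite extJ E F.
Qed.

(** * Covers and left-connected orientations *)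

Definition stable (T : finType) (a : {perm T}) (S : {set T}) :=
  [forall x, (x \in S) == (a x \in S)].

(** [restr_perm S a] degenerates to the identity when [a] does not preserve [S]; hence the stability
    hypotheses in what follows. *)
Definition tour (T : finType) (s a : {perm T}) (S : {set T}) : {perm T} := (restr_perm S a * s)%g.

Lemma stableP (T : finType) (a : {perm T}) (S : {set T}) :
  reflect (forall x, (a x \in S) = (x \in S)) (stable a S).
Proof. by apply: (iffP forallP) => H x; [rewrite (eqP (H x))|rewrite H]. Qed.

Lemma stable_norm (T : finType) (a : {perm T}) (S : {set T}) : stable a S -> a \in 'N(S | 'P)%g.
Proof.
by move/stableP => aS; apply/astabsP=> x; rewrite -[in RHS]aS.
Qed.

Lemma tourE (T : finType) (s a : {perm T}) (S : {set T}) x :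
  stable a S -> tour s a S x = if x \in S then s (a x) else s x.
Proof.
move=> aS; rewrite permM; case: ifP => Sx; first by rewrite restr_permE ?stable_norm.
by rewrite (out_perm (restr_perm_on _ _)) // Sx.
Qed.

Section Pointed.
Variables (X : finType) (x0 : X) (al : {perm X}).
Hypothesis alK : involutive al.
Hypothesis al_fix : forall x, (al x == x) = (x == x0).

Let al0 : al x0 = x0. Proof. by apply/eqP; rewrite al_fix. Qed.

Definition covering (sg : {perm X}) (S : {set X}) :=
  [&& stable al S, x0 \notin S & unicyclic (tour sg al S)].

Definition transv (J : {set X}) :=
  (x0 \in J) && [forall x, (x != x0) ==> ((al x \in J) != (x \in J))].

Definition leftstep (sg : {perm X}) (J : {set X}) x := if x \in J then al x else sg x.

Definition leftconn (sg : {perm X}) (J : {set X}) :=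
  transv J && [forall x, fconnect (leftstep sg J) x x0].

Lemma transvP J : transv J -> forall x, x != x0 -> (al x \in J) = (x \notin J).
Proof.
by case/andP=> _ /forallP H x nx; have := H x; rewrite nx /=; case: (_ \in _); case: (_ \in _).
Qed.

Lemma transv0 J : transv J -> x0 \in J.
Proof. by case/andP. Qed.

(** [al] maps the complement of [J] bijectively onto [J] without [x0]. *)
Lemma card_transv J : transv J -> #|X| = #|J|.*2.-1 /\ 0 < #|J|.
Proof.
move=> tJ; have J0 := transv0 tJ; have tJP := transvP tJ.
have J1 : 0 < #|J| by apply/card_gt0P; exists x0.
split=> //; have := cardsC J; have : #|~: J| = #|J :\ x0|.
  rewrite -(card_imset _ (@perm_inj _ al)); congr #|pred_of_set _|.
  apply/setP=> x; rewrite !inE; apply/imsetP/andP => [[y yJ ->]|[xx Jx]].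
    have y0 : y != x0 by apply: contraTneq yJ => ->; rewrite inE J0.
    by rewrite tJP // -in_setC yJ; split=> //; rewrite -[x0]al0 (inj_eq perm_inj).
  exists (al x); last by rewrite alK.
  by rewrite inE tJP // Jx.
by have := cardsD1 x0 J; rewrite J0 => -> -> <-; lia.
Qed.

Section Time.
Variables (sg : {perm X}) (S : {set X}).
Let t := tour sg al S.
Definition time := findex t x0.

Lemma time_iter x : x \in porbit t x0 -> iter (time x) t x0 = x.
Proof. by rewrite porbit_fconnect; exact: iter_findex. Qed.

(** [time] is the least index at which a point occurs; the induction removes whole periods. *)
Lemma time_le i : time (iter i t x0) <= i.
Proof.
elim/ltn_ind: i => i IH.
case: (ltnP i (fingraph.order t x0)) => [lt|le]; first by rewrite /time findex_iter.
rewrite -{1}(subnK le) iterD iter_order; last exact: perm_inj.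
have := @IH (i - fingraph.order t x0); have := fingraph.order_gt0 t x0; lia.
Qed.

Lemma time_step x : x \in porbit t x0 -> t x != x0 -> time (t x) = (time x).+1.
Proof.
by rewrite porbit_fconnect; exact: findex_step.
Qed.

Lemma time_inj : {in porbit t x0 &, injective time}.
Proof. by move=> x y /time_iter xE /time_iter yE E; rewrite -xE E yE. Qed.

Definition heads := [set x | (x \in S) == (time (al x) < time x)].

End Time.

(** Exchanging [x] and [al x] preserves membership in [S] but reverses the order of their times,
    which differ because [al] fixes only [x0]. *)
Lemma heads_transv sg S : covering sg S -> transv (heads sg S).
Proof.
case/and3P=> sS S0 /unicyclicP uS; apply/andP; split.
  by rewrite inE (negbTE S0) al0 ltnn.
apply/forallP=> x; apply/implyP=> nx; rewrite !inE alK (stableP _ _ sS).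
have : time sg S x != time sg S (al x).
  by apply: contra nx => /eqP/time_inj; rewrite !uS => /(_ isT isT) E; rewrite -al_fix -E.
by case: ltngtP => // _ _; case: (_ \in _).
Qed.

Section HeadsOfCover.
Variables (sg : {perm X}) (S : {set X}).
Hypothesis cS : covering sg S.
Notation J := (heads sg S).
Notation tm := (time sg S).
(* the second visit of the edge of x *)
Definition late x := maxn (tm x) (tm (al x)).

Let sS : stable al S. Proof. by case/and3P: cS. Qed.
Let uS x y : y \in porbit (tour sg al S) x.
Proof. by move: x y; apply/unicyclicP; case/and3P: cS. Qed.

(** The tour reaches [sg x] from [al x] if [x \in S] and from [x] otherwise; for [x \notin J] this
    is precisely the half of the edge visited second. *)
Lemma late_step x : x \notin J -> sg x != x0 -> tm (sg x) = (late x).+1.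
Proof.
rewrite inE /late => xJ nx.
pose y := if x \in S then al x else x.
have yE : tour sg al S y = sg x.
  by rewrite tourE // /y; case Sx: (x \in S); rewrite ?(stableP _ _ sS) Sx ?alK.
rewrite -yE time_step ?yE // /y.
by move: xJ; case: (x \in S); case: ltnP => //= l _; lia.
Qed.

(** Along the walk, [late] is unchanged by [al] and grows strictly under [sg] as long as [x0] is not
    reached. Being below [#|X|], it cannot grow forever. *)
Lemma heads_leftconn : leftconn sg J.
Proof.
apply/andP; split; first exact: heads_transv.
have tJ := transvP (heads_transv cS).
have J0 := transv0 (heads_transv cS).
have nJ x : x \notin J -> x != x0 by apply: contraNneq => ->.
suff H n x : x \notin J -> #|X| - late x <= n -> fconnect (leftstep sg J) x x0.
  apply/forallP=> x; case: (eqVneq x x0) => [->|nx]; first exact: connect0.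
  case: (boolP (x \in J)) => Jx; last exact: (H _ _ Jx (leqnn _)).
  apply: connect_trans (fconnect1 _ _) _; rewrite /leftstep Jx.
  by apply: (H _ _ _ (leqnn _)); rewrite tJ ?Jx.
elim: n x => [|n IH] x Jx le.
  exfalso; have lt y : tm y < #|X|.
    have := uS x0 y; rewrite porbit_fconnect => /findex_max lt.
    by apply: leq_trans lt (max_card _).
  by have := lt x; have := lt (al x); move: le; rewrite /late; lia.
apply: connect_trans (fconnect1 _ _) _; rewrite /leftstep (negbTE Jx).
case: (eqVneq (sg x) x0) => [->|nx]; first exact: connect0.
have lt : late x < late (sg x) by rewrite {2}/late (late_step Jx nx) leq_max ltnSn.
case: (boolP (sg x \in J)) => Jsx; last by apply: IH => //; lia.
apply: connect_trans (fconnect1 _ _) _; rewrite /leftstep Jsx.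
apply: IH; first by rewrite tJ ?Jsx.
by have : late (al (sg x)) = late (sg x) by [rewrite /late alK maxnC]; lia.
Qed.

(* If every sg-cycle has a single head, then the cycle of a head j <> x0 outside
   of S would start right after the visit of j and end strictly before it. *)
Lemma cover_all_of_single_heads :
  {in J, forall x, restr sg J x = x} -> tour sg al S = (al * sg)%g.
Proof.
move=> one; have tJ := transvP (heads_transv cS).
have J0 := transv0 (heads_transv cS).
have nJ x : x \notin J -> x != x0 by apply: contraNneq => ->.
have inS x : x \in J -> x != x0 -> x \in S.
  move=> Jx nx; apply/negPn/negP => Sx.
  have [k [kE _ kJ]] := restr_returns sg Jx; rewrite one // in kE.
  have xt : tour sg al S x = sg x by rewrite tourE // (negbTE Sx).
  (* A fixed point of [sg] outside [S] is fixed by the tour, whose single cycle contains [x0]. *)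
  have sx : sg x != x.
    apply: contra nx => /eqP sx; have /porbit_iterP[i <-] := uS x x0.
    by apply/eqP; elim: i => //= i <-; rewrite xt sx.
  have k0 : 0 < k by case: k kE {kJ} => // /eqP; rewrite (negbTE sx).
  (* The later points of the [sg]-cycle of [x] are not heads, so their tour times stay above that of
     [x]. *)
  have H i : i < k -> tm x < tm (iter i.+1 sg x).
    elim: i => [|i IH] lt.
      by rewrite /= -xt time_step // xt; apply: nJ; exact: (kJ 0).
    have lti := ltnW lt.
    rewrite iterS late_step ?kJ //; last by rewrite -iterS nJ ?kJ.
    by rewrite ltnS; apply: leq_trans (ltnW (IH lti)) _; rewrite leq_maxl.
  have lt : k.-1 < k by rewrite prednK.
  (* The last point of the cycle is visited after [x], whereas [late_step] makes its late time the
     predecessor of [tm x]. *)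
  have := H _ lt; have jk := kJ _ lt; rewrite prednK // in jk *; move=> ltk.
  by have := late_step jk; rewrite -iterS kE => /(_ nx); rewrite /late; lia.
apply/permP=> x; rewrite tourE // permM.
case: ifP => // /negbT Sx; case: (eqVneq x x0) => [->|nx]; first by rewrite al0.
case: (boolP (x \in J)) => Jx; first by rewrite inS in Sx.
case/negP: Sx; rewrite -(stableP _ _ sS) inS ?tJ //.
by rewrite -[x0]al0 (inj_eq perm_inj).
Qed.

End HeadsOfCover.

(** Both tours are replayed simultaneously. If the edge of the current point was met before, its
    membership in [S] and [S'] agrees by induction and stability. At a first visit, membership is
    the negation of being a head, so equal heads force the same next step. *)
Lemma heads_inj sg : {in covering sg &, injective (heads sg)}.
Proof.
move=> S S' cS cS' E; have /and3P[sS S0 uS] := cS; have /and3P[sS' S0' uS'] := cS'.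
set t := tour sg al S; set t' := tour sg al S'.
have cx x : x \in porbit t x0 by apply/unicyclicP.
have cx' x : x \in porbit t' x0 by apply/unicyclicP.
have H k i : i < k -> iter i t x0 = iter i t' x0 /\ (iter i t x0 \in S) = (iter i t x0 \in S').
  elim: k i => // k IH i; rewrite ltnS => ik.
  have Ei : iter i t x0 = iter i t' x0.
    case: i ik => // i ik; have [Ex ES] := IH i ik.
    by rewrite !iterS -Ex !tourE // ES.
  split=> //; set x := iter i t x0.
  case: (eqVneq x x0) => [->|nx]; first by rewrite (negbTE S0) (negbTE S0').
  case: (boolP [exists j : 'I_i, iter j t x0 \in [:: x; al x]]).
    move=> /existsP[j]; have [jE jS] := IH j (leq_trans (ltn_ord j) ik).
    rewrite !inE => /orP[] /eqP jx; rewrite jx // in jS.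
    by rewrite !(stableP _ _ sS) !(stableP _ _ sS') in jS.
  rewrite negb_exists => /forallP no.
  have late_al : time sg S x < time sg S (al x).
    rewrite ltnNge; apply/negP => le.
    have : time sg S (al x) < i.
      apply: leq_trans (time_le sg S i); rewrite ltn_neqAle le andbT.
      by apply: contra nx => /eqP/time_inj; rewrite !cx => /(_ isT isT) e; rewrite -al_fix e.
    by move=> lt; have /negP := no (Ordinal lt); rewrite time_iter // !inE eqxx orbT.
  have late_al' : time sg S' x < time sg S' (al x).
    rewrite ltnNge; apply/negP => le.
    have : time sg S' (al x) < i.
      apply: leq_trans (time_le sg S' i); rewrite -/t' -Ei ltn_neqAle le andbT.
      by apply: contra nx => /eqP/time_inj; rewrite !cx' => /(_ isT isT) e; rewrite -al_fix e.
    move=> lt; have /negP := no (Ordinal lt).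
    have [-> _] := IH _ (leq_trans lt ik); by rewrite time_iter // !inE eqxx orbT.
  move/setP/(_ x): E; rewrite !inE !ltnNge (ltnW late_al) (ltnW late_al') /=.
  by case: (x \in S); case: (x \in S').
apply/setP=> x; have [_] := H _ _ (ltnSn (time sg S x)).
by rewrite time_iter.
Qed.

(** [S] is corrected edge by edge along its own tour until each first visit obeys [J];
    left-connectedness then forces the final tour to pass everywhere. *)
Lemma leftconn_heads sg J : leftconn sg J -> exists2 S, covering sg S & heads sg S = J.
Proof.
move=> /andP[tvJ /forallP conn]; have tJ := transvP tvJ; have J0 := transv0 tvJ.
pose good S i := let x := iter i (tour sg al S) x0 in
  [forall j : 'I_i, iter j (tour sg al S) x0 \notin [:: x; al x]] -> x != x0 ->
  (x \in S) = (x \notin J).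
have build k : exists S, [/\ stable al S, x0 \notin S & forall i, i < k -> good S i].
  elim: k => [|k [S [sS S0 gS]]].
    by exists set0; split; rewrite ?inE //; apply/stableP=> x; rewrite !inE.
  pose t := tour sg al S; pose x := iter k t x0.
  case: (boolP [&& [forall j : 'I_k, iter j t x0 \notin [:: x; al x]], x != x0 &
    (x \in S) == (x \in J)]); last first.
    move=> bad; exists S; split=> // i; rewrite ltnS leq_eqVlt => /predU1P[->|]; last exact: gS.
    move=> new nx; move: bad; rewrite new nx /= -/x.
    by case: (x \in S); case: (x \in J).
  case/and3P=> /forallP new nx /eqP Sx.
  (* Step [k] is a first visit that disobeys [J], so its edge is toggled. No earlier step touches
     this edge, so the tour is unchanged up to step [k]. *)
  pose S' := [set y | (y \in S) (+) (y \in [:: x; al x])].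
  have sS' : stable al S'.
    apply/stableP=> y; rewrite !inE (stableP _ _ sS) -{1}(alK x) !(inj_eq perm_inj).
    by rewrite orbC.
  have agree i : i <= k -> iter i (tour sg al S') x0 = iter i t x0.
    elim: i => // i IH ik; rewrite !iterS IH ?(ltnW ik) // !tourE //.
    by have := new (Ordinal ik); rewrite /= [_ \in S']inE => /negbTE ->; rewrite addbF.
  exists S'; split=> //.
    rewrite !inE (negbTE S0) /= negb_or eq_sym nx /=.
    by rewrite -al0 (inj_eq perm_inj) eq_sym.
  move=> i; rewrite ltnS leq_eqVlt => /predU1P[->|ik].
    by move=> _ _; rewrite agree // -/x !inE eqxx Sx; case: (x \in J).
  move=> newi nxi; have := gS i ik; rewrite /good.
  move: newi nxi; rewrite agree ?(ltnW ik) // => /forallP newi nxi g.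
  have := new (Ordinal ik); rewrite [_ \in S']inE /= => /negbTE ->; rewrite addbF.
  apply: g => //; apply/forallP=> j; have := newi j.
  by rewrite agree // (leq_trans (ltnW (ltn_ord j))) // ltnW.
(* [#|X|] steps exhaust the cycle of [x0]. *)
have [S [sS S0 gS]] := build #|X|; set t := tour sg al S.
have first_visit x : x \in porbit t x0 -> x != x0 ->
  (al x \notin porbit t x0) || (time sg S x < time sg S (al x)) -> (x \in S) = (x \notin J).
  move=> cx nx nal; have xE := time_iter cx.
  have lt : time sg S x < #|X|.
    move: cx; rewrite porbit_fconnect => /findex_max lt.
    by apply: leq_trans lt (max_card _).
  have := gS _ lt; rewrite /good xE; apply=> //.
  apply/forallP=> j; rewrite !inE; apply/norP; split; apply/negP => /eqP jE.
    by have := time_le sg S j; rewrite -/t jE leqNgt ltn_ord.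
  move: nal; rewrite -jE mem_porbit_iter /= => ltj.
  by have := leq_trans ltj (time_le sg S j); rewrite ltnNge ltnW.
have Jn x : x \notin J -> x != x0 by apply: contraNneq => ->.
(* The tour predecessor of [sg x] is one half of the edge of [x]. Were the other half off the cycle,
   the visited half would be a first visit whose membership in [S] contradicts [J]. *)
have back x : x \notin J -> sg x \in porbit t x0 -> x \in porbit t x0 /\ al x \in porbit t x0.
  move=> Jx; have nx := Jn _ Jx; have nax : al x != x0 by rewrite -[x0]al0 (inj_eq perm_inj).
  pose y := if x \in S then al x else x.
  have -> : sg x = t y.
    by rewrite /t tourE // /y; case Sx: (x \in S); rewrite ?(stableP _ _ sS) Sx ?alK.
  move=> cty; have cy : y \in porbit t x0.
    rewrite porbit_sym; have := cty; rewrite porbit_sym.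
    have : t y \in porbit t y := mem_porbit_iter t 1 y.
    by rewrite -!eq_porbit_mem => /eqP -> /eqP ->.
  move: cy; rewrite /y; case: ifP => Sx cy; split=> //; apply/negPn/negP => nc.
    have := first_visit _ cy nax; rewrite alK nc (stableP _ _ sS) Sx tJ // Jx.
    by move=> /(_ isT).
  have := first_visit _ cy nx; rewrite nc Sx Jx.
  by move=> /(_ isT).
(* Induction on the length of the left walk from [x] to [x0]. The clause on [al x] carries the
   induction through the steps made by [al]. *)
have all x : x \in porbit t x0 /\ (x \notin J -> al x \in porbit t x0).
  have := iter_findex (conn x); move: (findex _ _ _) => n; elim: n x => [|n IH] x.
    by move=> /= ->; rewrite porbit_id J0.
  rewrite iterSr => /IH []; rewrite {1 2 3}/leftstep; case: ifP => [Jx|/negbT Jx].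
    move=> cax; case: (eqVneq x x0) => [->|nx]; first by rewrite porbit_id.
    by rewrite tJ // Jx alK => /(_ isT).
  by move=> /(back _ Jx) [].
have uS : unicyclic t.
  apply/unicyclicP => x y; have [cx _] := all x; have [cy _] := all y.
  by move: cx; rewrite -eq_porbit_mem => /eqP ->.
have cS : covering sg S by rewrite /covering sS S0.
exists S => //; apply/setP=> x; rewrite inE.
case: (eqVneq x x0) => [->|nx]; first by rewrite (negbTE S0) al0 ltnn J0.
have nax : al x != x0 by rewrite -[x0]al0 (inj_eq perm_inj).
have [cx _] := all x; have [cax _] := all (al x).
case: (ltngtP (time sg S x) (time sg S (al x))) => [lt|lt|/time_inj E].
- by rewrite first_visit ?lt ?orbT //; case: (x \in J).
- by rewrite -(stableP _ _ sS) first_visit ?alK ?lt ?orbT // tJ // negbK; case: (x \in J).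
- by case/eqP: nx; apply/eqP; rewrite -al_fix -E.
Qed.

Lemma card_cover_leftconn sg : #|[set S | covering sg S]| = #|[set J | leftconn sg J]|.
Proof.
rewrite -(card_in_imset (f := heads sg)); last first.
  by move=> S S'; rewrite !inE; exact: heads_inj.
congr #|pred_of_set _|; apply/setP=> J; rewrite inE; apply/imsetP/idP.
  by move=> [S]; rewrite inE => cS ->; exact: heads_leftconn.
by move=> /leftconn_heads[S cS <-]; exists S; rewrite ?inE.
Qed.

(** * Cosets of the group of permutations supported on [J] *)

Lemma eq_leftconn (sg sg' : {perm X}) (J : {set X}) : (forall x, x \notin J -> sg x = sg' x) ->
  leftconn sg J = leftconn sg' J.
Proof.
move=> E; rewrite /leftconn; congr andb; apply: eq_forallb => x.
apply: eq_fconnect => y; rewrite /leftstep; case: ifP => // /negbT; exact: E.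
Qed.

Lemma leftconn_mul (sg : {perm X}) (J : {set X}) (p : {perm X}) :
  perm_on J p -> leftconn (p * sg)%g J = leftconn sg J.
Proof. by move=> pJ; apply: eq_leftconn => x Jx; rewrite permM (out_perm pJ). Qed.

(** On a cycle avoiding [J] the walk would follow [sg] forever and miss [x0], which lies in [J]. *)
Lemma leftconn_meet sg J : leftconn sg J -> forall x, exists2 y, y \in porbit sg x & y \in J.
Proof.
move=> /andP[tJ /forallP conn] x.
case: (boolP [exists y in porbit sg x, y \in J]) => [/existsP[y /andP[]]|no].
  by exists y.
have noJ y : y \in porbit sg x -> y \notin J.
  by move=> xy; apply: contra no => Jy; apply/existsP; exists y; rewrite xy.
have H i : iter i (leftstep sg J) x = iter i sg x.
  by elim: i => //= i ->; rewrite /leftstep (negbTE (noJ _ (mem_porbit_iter _ _ _))).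
have := iter_findex (conn x); rewrite H => E.
by have := noJ _ (mem_porbit_iter sg (findex (leftstep sg J) x x0) x); rewrite E (transv0 tJ).
Qed.

(* Multiplying by a transposition of two heads in a common cycle splits this
   cycle, so a product with the maximal number of cycles has a single head in each. *)
Lemma single_heads (sg : {perm X}) (J : {set X}) : exists2 k, perm_on J k &
  {in J, forall x, restr (k * sg)%g J x = x}.
Proof.
have on1 : perm_on J 1%g by exact: perm_on1.
case: (arg_maxnP (fun k : {perm X} => #|porbits (k * sg)%g|) on1) => k kJ kmax.
exists k => // x Jx; set y := restr _ _ _; apply/eqP; apply/negPn/negP => nyx.
have Jy : y \in J by rewrite restr_in.
have tJ : perm_on J (tperm x y).
  apply/subsetP=> z; rewrite !inE; apply: contraR => Jz.
  by rewrite tpermD //; apply: contraNneq Jz => <-.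
have := kmax (tperm x y * k)%g (perm_onM tJ kJ).
have /= := porbits_mul_tperm (k * sg)%g x y; rewrite mulgA.
by rewrite porbit_sym restr_porbit /= eq_sym nyx addn0 addn1 /geq /= => ->; rewrite ltnn.
Qed.

(** The pair comes from some cover, and with single heads the tour of that cover is [al * sg]. *)
Lemma unicyclic_of_single_heads sg J : leftconn sg J -> {in J, forall x, restr sg J x = x} ->
  unicyclic (al * sg)%g.
Proof.
move=> lc one; have [S cS SJ] := leftconn_heads lc.
rewrite -(cover_all_of_single_heads cS) ?SJ //.
by case/and3P: cS.
Qed.

(** Once the base point [sg] is replaced by some [k * sg] with single heads, [k * sg * al] is a long
    cycle and [card_perm_on_porbits] applies. *)
Lemma card_leftconn_coset (sg : {perm X}) (J : {set X}) (Q : nat -> nat -> bool) : leftconn sg J ->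
  #|[set p | perm_on J p && Q #|porbits (p * sg)%g| #|porbits (al * (p * sg))%g| ]|
  = npairs Q #|J|.
Proof.
move=> lc; have [k kJ one] := single_heads sg J.
have lck : leftconn (k * sg)%g J by rewrite leftconn_mul.
rewrite -(@card_perm_on_porbits _ (k * sg)%g (k * sg * al)%g J) //; first last.
- by have [] := card_transv (proj1 (andP lc)).
- by rewrite /unicyclic card_porbits_mulC; exact: unicyclic_of_single_heads lck one.
- exact: leftconn_meet.
(* Change of base point in the coset: [p] becomes [p * k^-1]. *)
rewrite -(card_imset _ (mulIg k^-1%g)); congr #|pred_of_set _|.
apply/setP=> q; rewrite inE [X in Q _ X](_ : _ = #|porbits (al * (q * (k * sg)))%g|); last first.
  by rewrite card_porbits_mulC !mulgA.
apply/imsetP/andP => [[p]|[qJ Qq]].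
  rewrite inE => /andP[pJ Qp] ->; rewrite mulgA mulgKV; split=> //.
  by apply: perm_onM => //; rewrite perm_onV.
exists (q * k)%g; last by rewrite mulgK.
by rewrite inE -!mulgA Qq andbT; exact: perm_onM.
Qed.

(** The pairs of [sg] and [p] with [q (p * sg)] are counted twice: for fixed [sg] the coset lemma
    gives [npairs]; for fixed [p] the substitution of [p^-1 * sg] for [sg] makes [p] disappear. *)
Lemma card_leftconn_stat (J : {set X}) (Q : nat -> nat -> bool) :
  #|J|`! * #|[set sg | leftconn sg J && Q #|porbits sg| #|porbits (al * sg)%g| ]|
  = #|[set sg | leftconn sg J]| * npairs Q #|J|.
Proof.
pose q sg := Q #|porbits sg| #|porbits (al * sg)%g|.
have L : \sum_(sg | leftconn sg J) \sum_(p | perm_on J p) (q (p * sg)%g : nat)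
  = #|[set sg | leftconn sg J]| * npairs Q #|J|.
  rewrite (eq_bigr (fun=> npairs Q #|J|)) ?sum_nat_const ?cardsE // => sg lc.
  rewrite -(card_leftconn_coset Q lc) -sum1dep_card big_mkcondr /=.
  by apply: eq_bigr => p _; rewrite -/(q _); case: (q _).
rewrite -L exchange_big /= -card_perm -sum_nat_const.
apply: eq_bigr => p pJ; rewrite -sum1dep_card big_mkcondr /=.
rewrite [RHS](reindex_inj (mulgI p^-1%g)) /=; apply: eq_big => sg.
  by rewrite leftconn_mul // perm_onV.
by move=> _; rewrite mulKVg -/(q _); case: (q _).
Qed.

End Pointed.

(** * Covered maps as one-cycle tours *)

Definition fpfree (T : finType) (a : {perm T}) := [forall x, (a (a x) == x) && (a x != x)].

Lemma fpfreeP (T : finType) (a : {perm T}) :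
  reflect (involutive a /\ forall x, a x != x) (fpfree a).
Proof.
apply: (iffP forallP) => [H|[aK a_fix] x]; last by rewrite aK eqxx a_fix.
by split=> x; case/andP: (H x) => /eqP.
Qed.

Section CoverTour.
Variables (T : finType) (s a : {perm T}) (r : option T) (B : {set T}).

Lemma unicyclic_connect (t : {perm T}) : unicyclic t ->
  (forall x, connect (step_rel s a) x (t x)) -> forall x y, connect (step_rel s a) x y.
Proof.
move=> /unicyclicP ut H x y; have := ut x y; rewrite porbit_fconnect.
by apply: connect_sub => u v /eqP <-.
Qed.

Lemma tour_set0 : tour s a set0 = s.
Proof.
apply/permP=> x; rewrite permM (out_perm (restr_perm_on _ _)) //.
by rewrite inE.
Qed.

Lemma restr_tour x : stable a B -> restr (tour s a B) B x = restr s B (restr a B x).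
Proof.
move=> aB; case: (boolP (x \in B)) => Bx; last by rewrite !restr_notin.
rewrite restr_mul ?restr_perm_on // restr_permE ?stable_norm // (restr_step Bx) //.
by rewrite (stableP _ _ aB).
Qed.

(** A one-cycle tour makes [s] and [a] transitive, and its first return to [B] is the face
    permutation of the submap. The tour and [s] differ by a permutation of [B], so all cycles of one
    meet [B] iff all cycles of the other do. For empty [B] the tour is [s], and there is one
    vertex. *)
Lemma is_map_coverE : is_map s a r && is_cover s a B =
  [&& fpfree a, (r == None) == (#|T| == 0), stable a B & unicyclic (tour s a B)].
Proof.
have fE x y : stable a B -> fconnect (fun z => restr s B (restr a B z)) x y
    = fconnect (restr (tour s a B) B) x y.
  by move=> aB; apply: eq_fconnect => z; rewrite restr_tour.
apply/andP/and4P => [[/and3P[fa _ rT] /and4P[aB _ meet cyc]]|[fa rT aB ut]].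
  split=> //; case/orP: meet => [/forallP meet|/andP[/eqP B0 v1]]; last first.
    by rewrite /unicyclic B0 tour_set0; move: v1; rewrite /nverts; lia.
  have meet' : forall x, exists2 y, y \in porbit (tour s a B) x & y \in B.
    apply: porbit_meet_mul (restr_perm_on _ _) _ => x.
    by have /existsP[y /andP[By xy]] := meet x; exists y.
  apply/unicyclicP=> x y.
  have [x' xx' Bx'] := meet' x; have [y' yy' By'] := meet' y.
  have : y' \in porbit (tour s a B) x'.
    rewrite -(restr_fconnect _ Bx' By') -fE //.
    by move/forallP/(_ x'): cyc; rewrite Bx' => /forallP/(_ y'); rewrite By'.
  move: xx' yy'; rewrite porbit_sym -!eq_porbit_mem => /eqP <- /eqP <- /eqP E.
  by rewrite E.
have ts x : connect (step_rel s a) x (tour s a B x).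
  rewrite tourE //; case: ifP => Bx; last by apply: connect1; rewrite /step_rel eqxx.
  apply: (@connect_trans _ _ (a x)); apply: connect1; rewrite /step_rel eqxx ?orbT //.
have cyc x y : x \in B -> y \in B -> fconnect (fun z => restr s B (restr a B z)) x y.
  by move=> Bx By; rewrite fE // restr_fconnect //; apply/unicyclicP.
split; apply/and3P; split=> //.
- by apply/forallP=> x; apply/forallP=> y; exact: unicyclic_connect ut ts x y.
- apply/forallP=> x; apply/implyP=> Bx; apply/forallP=> y; apply/implyP=> By.
  apply: connect_sub (cyc x y Bx By) => u v /eqP <-.
  by apply: (@connect_trans _ _ (restr a B u)); apply: connect1; rewrite /step_rel eqxx ?orbT.
- apply/andP; split; last first.
    by apply/forallP=> x; apply/implyP=> Bx; apply/forallP=> y; apply/implyP; exact: cyc.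
  have [B0|/set0Pn[b Bb]] := eqVneq B set0.
    by move: ut; rewrite /unicyclic B0 tour_set0 /nverts; lia.
  apply/orP; left; apply/forallP=> x.
  have -> : s = ((restr_perm B a)^-1 * tour s a B)%g by rewrite mulKg.
  have [||y xy By] := @porbit_meet_mul _ (tour s a B) (restr_perm B a)^-1%g B _ _ x.
  - exact/perm_onV/restr_perm_on.
  - by move=> z; exists b => //; apply/unicyclicP.
  - by apply/existsP; exists y; rewrite By.
Qed.

End CoverTour.

(** * The root as an extra point *)

Section RootPoint.
Variable T : finType.
Implicit Types (s a : {perm T}) (r : option T) (B : {set T}).

Let Sinj : injective (@Some T). Proof. by move=> x y []. Qed.

Definition lift_option s : {perm option T} := ext Sinj s.

(* the root pointer r becomes an extra point None, inserted just before r in its cycle *)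
Definition insert s r : {perm option T} := (lift_option s * tperm None r)%g.

Lemma lift_Some s x : lift_option s (Some x) = Some (s x).
Proof. exact: extE. Qed.

Lemma lift_None s : lift_option s None = None.
Proof. by apply: ext_out; apply/codomP => -[]. Qed.

Lemma insert_None s r : insert s r None = r.
Proof. by rewrite permM lift_None tpermL. Qed.

Lemma insert_Some s r x : insert s r (Some x) = if r == Some (s x) then None else Some (s x).
Proof.
rewrite permM lift_Some; case: tpermP => //; first by move=> ->; rewrite eqxx.
by move=> _ /eqP; rewrite eq_sym => /negbTE ->.
Qed.

(** [None] joins the cycle of the root and is bypassed by first returns to the other points. Without
    half-edges it is alone, which matches the convention that the empty map has one vertex and one
    face. *)
Lemma card_porbits_insert s r : (r == None) == (#|T| == 0) ->
  #|porbits (insert s r)| = maxn 1 #|porbits s|.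
Proof.
case: r => [x|] /=; last first.
  rewrite eqxx eq_sym eqb_id => /eqP T0.
  have -> : #|porbits s| = 0.
    by apply/eqP; rewrite -leqn0 -T0; exact: leq_trans (leq_imset_card _ _) (max_card _).
  have le : #|porbits (insert s None)| <= #|{: option T}| by apply: leq_imset_card.
  rewrite card_option T0 in le.
  have : 0 < #|porbits (insert s None)|.
    by apply/card_gt0P; exists (porbit (insert s None) None); exact: imset_f.
  by rewrite maxn0 => lt; apply/eqP; rewrite eqn_leq le lt.
move=> _; pose J : {set option T} := ~: [set None].
have Js y : Some y \in J by rewrite !inE.
have <- : #|porbits (insert s (Some x))| = #|porbits s|.
  apply: (@card_porbits_return_all _ _ J _ Some) => //.
  - move=> [y|]; rewrite !inE /=; first by rewrite codom_f.
    by apply/esym/negbTE/codomP => -[].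
  - move=> y; case: (eqVneq (s y) x) => [E|nE]; last first.
      have E : insert s (Some x) (Some y) = Some (s y).
        by rewrite insert_Some (inj_eq Sinj) eq_sym (negbTE nE).
      by rewrite restr_step ?E.
    (* The passage through [None] makes this return take two steps. *)
    apply: restr_returnsE => //; exists 1; split=> //=.
      by rewrite insert_Some E eqxx insert_None.
    by case=> // _; rewrite /= insert_Some E eqxx !inE.
  - case=> [y|]; first by exists (Some y); rewrite ?porbit_id.
    exists (Some x) => //.
    by have := mem_porbit_iter (insert s (Some x)) 1 None; rewrite /= insert_None.
have : 0 < #|porbits (insert s (Some x))|.
  by apply/card_gt0P; exists (porbit (insert s (Some x)) None); exact: imset_f.
by move=> lt; apply/esym/maxn_idPr.
Qed.

Lemma insertM s a r : (lift_option a * insert s r)%g = insert (a * s) r.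
Proof. by rewrite /insert /lift_option extM mulgA. Qed.

Lemma stable_lift a B : stable (lift_option a) (Some @: B) = stable a B.
Proof.
apply/stableP/stableP => H x.
  by have := H (Some x); rewrite lift_Some !(mem_imset _ _ Sinj).
case: x => [x|]; last by rewrite lift_None.
by rewrite lift_Some !(mem_imset _ _ Sinj).
Qed.

Lemma tour_insert s a r B : stable a B ->
  tour (insert s r) (lift_option a) (Some @: B) = insert (tour s a B) r.
Proof.
move=> aB; apply/permP=> x; rewrite tourE ?stable_lift // -insertM permM.
case: x => [x|].
  rewrite (mem_imset _ _ Sinj) !lift_Some.
  case: ifP => Bx; first by rewrite restr_permE ?stable_norm.
  by rewrite (out_perm (restr_perm_on _ _)) // Bx.
by rewrite !lift_None; case: ifP => //; case/imsetP.
Qed.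

End RootPoint.

Definition pinv (X : finType) (x0 : X) (al : {perm X}) :=
  [forall x, (al (al x) == x) && ((al x == x) == (x == x0))].

Lemma pinvP (X : finType) (x0 : X) (al : {perm X}) :
  reflect (involutive al /\ forall x, (al x == x) = (x == x0)) (pinv x0 al).
Proof.
apply: (iffP forallP) => [H|[aK a_fix] x]; last by rewrite aK a_fix !eqxx.
by split=> x; case/andP: (H x) => /eqP ? /eqP.
Qed.

Definition marked (X : finType) (x0 : X) (Q : nat -> nat -> bool) :
    pred ({perm X} * {perm X} * {set X}) := fun y => let: (al, sg, C) := y in
  [&& pinv x0 al, covering x0 al sg C & Q #|porbits sg| #|porbits (al * sg)%g| ].

Lemma sum_bool (T : finType) (P : pred T) : \sum_x (P x : nat) = #|[set x | P x]|.
Proof.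
by rewrite -sum1dep_card [RHS]big_mkcond; apply: eq_bigr => x _; case: (P x).
Qed.

(** [Q] does not see the cover, so for fixed [al] and [sg] the covers can be traded for the
    left-connected sets [J]. *)
Lemma card_marked_sum (X : finType) (x0 : X) Q : #|marked x0 Q| =
  \sum_(al | pinv x0 al) \sum_J
    #|[set sg | leftconn x0 al sg J && Q #|porbits sg| #|porbits (al * sg)%g| ]|.
Proof.
pose q (al sg : {perm X}) := Q #|porbits sg| #|porbits (al * sg)%g|.
transitivity (\sum_al \sum_sg \sum_S ([&& pinv x0 al, covering x0 al sg S & q al sg] : nat)).
  rewrite pair_bigA /= pair_bigA /= sum_bool.
  by apply: eq_card => -[[al sg] S]; rewrite inE.
rewrite [RHS]big_mkcond; apply: eq_bigr => al _ /=.
case: (boolP (pinv x0 al)) => /= [/pinvP[alK al_fix]|_]; last first.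
  by rewrite big1 // => sg _; rewrite big1.
transitivity (\sum_sg \sum_J (leftconn x0 al sg J && q al sg : nat)); last first.
  by rewrite exchange_big; apply: eq_bigr => J _; rewrite sum_bool.
apply: eq_bigr => sg _; rewrite !sum_bool.
case: (q al sg); last by apply: eq_card => J; rewrite !inE !andbF.
transitivity #|[set S | covering x0 al sg S]|; first by apply: eq_card => S; rewrite !inE andbT.
by rewrite card_cover_leftconn //; apply: eq_card => J; rewrite !inE andbT.
Qed.

(** The identity holds for each [al] and [J] separately: a transversal has [n.+1] elements, and any
    other [J] contributes nothing. *)
Lemma card_marked (X : finType) (x0 : X) Q n : #|X| = n.*2.+1 ->
  n.+1`! * #|marked x0 Q| = #|marked x0 (fun _ _ => true)| * npairs Q n.+1.
Proof.
move=> Xn; rewrite !card_marked_sum big_distrr big_distrl /=.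
apply: eq_bigr => al /pinvP[alK al_fix].
rewrite big_distrr big_distrl /=; apply: eq_bigr => J _.
case: (boolP (transv x0 al J)) => tJ; last first.
  have E (P : pred {perm X}) : #|[set sg | leftconn x0 al sg J && P sg]| = 0.
    by apply/eqP; rewrite cards_eq0; apply/eqP/setP=> sg; rewrite !inE /leftconn (negbTE tJ).
  by rewrite !E muln0.
have [XJ J0] := card_transv alK al_fix tJ.
have <- : #|J| = n.+1 by move: XJ J0; rewrite Xn; lia.
rewrite card_leftconn_stat //; congr (_ * _).
by apply: eq_card => sg; rewrite !inE andbT.
Qed.

Section Covered.
Variable T : finType.

Definition covered_stat (Q : nat -> nat -> bool) : pred (CovT T) := fun X =>
  let: (s, a, r, B) := X in [&& is_map s a r, is_cover s a B & Q (nverts s) (nfaces s a)].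

Lemma lift_onto (p : {perm option T}) : p None = None -> exists u, p = lift_option u.
Proof.
move=> p0; apply: perm_on_ext; apply/subsetP=> -[x _|].
  by rewrite inE; exact: codom_f.
by move=> /[!inE] /=; rewrite p0 eqxx.
Qed.

Lemma pinv_lift (a : {perm T}) : pinv None (lift_option a) = fpfree a.
Proof.
apply/pinvP/fpfreeP => -[aK a_fix]; split.
- by move=> x; have := aK (Some x); rewrite !lift_Some => -[].
- by move=> x; apply/eqP => E; have := a_fix (Some x); rewrite lift_Some E eqxx.
- by case=> [x|]; rewrite ?lift_None // !lift_Some aK.
- case=> [x|]; last by rewrite lift_None !eqxx.
  by rewrite lift_Some; apply/negbTE/eqP => -[] /eqP; rewrite (negbTE (a_fix x)).
Qed.

(** The encoding [F] is invertible: the root is the image of [None], and undoing the transposition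
    leaves a permutation fixing [None]. *)
Lemma card_covered Q : #|covered_stat Q| = #|marked (None : option T) Q|.
Proof.
pose F (X : CovT T) := let: (s, a, r, B) := X in (lift_option a, insert s r, Some @: B).
have Sinj : injective (@Some T) by move=> x y [].
have Finj : injective F.
  move=> [[[s a] r] B] [[[s' a'] r'] B'] [/ext_inj -> E /(imset_inj Sinj) ->].
  have rr : r = r' by rewrite -(insert_None s r) E insert_None.
  by move: E; rewrite rr => /mulIg /ext_inj ->.
rewrite -(card_imset _ Finj); apply: eq_card => -[[al sg] S].
have FE s a r B : covered_stat Q (s, a, r, B) =
    ((r == None) == (#|T| == 0)) && marked None Q (F (s, a, r, B)).
  rewrite /= andbA is_map_coverE pinv_lift.
  case: (boolP (fpfree a)) => //= fa; last by rewrite andbF.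
  case: (boolP (_ == (#|T| == 0))) => //= rT.
  rewrite /covering stable_lift; case: (boolP (stable a B)) => //= aB.
  rewrite tour_insert // insertM /unicyclic !card_porbits_insert // geq_max /=.
  by case: imsetP => [[]|].
(* If [r] is [None], the tour fixes the extra point, and having a single cycle it leaves room for no
   half-edge. *)
have empty s r B a : marked None Q (F (s, a, r, B)) -> (r == None) == (#|T| == 0).
  move=> /and3P[_ /and3P[sS _ ut] _]; rewrite stable_lift in sS.
  move: ut; rewrite tour_insert // => /unicyclicP ut.
  case: r ut => [x|] ut /=.
    by apply/eqP/esym/negbTE; rewrite -lt0n; apply/card_gt0P; exists x.
  rewrite eq_sym eqb_id; apply/eqP/eq_card0 => x; exfalso.
  have /porbit_iterP[i] := ut None (Some x).
  suff -> : iter i (insert (tour s a B) None) None = None by [].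
  by elim: i => //= i ->; rewrite insert_None.
apply/imsetP/idP => [[[[[s a] r] B]]|].
  by rewrite [_ \in covered_stat Q]FE => /andP[_ m] ->.
move=> mm; have m : marked None Q (al, sg, S) := mm.
have /and3P[/pinvP[_ al_fix] /and3P[_ S0 _] _] := m.
have [a aE] : exists a, al = lift_option a by apply: lift_onto; apply/eqP; rewrite al_fix.
have [s sE] : exists s, (sg * tperm None (sg None))%g = lift_option s.
  have [|u ->] := @lift_onto (sg * tperm None (sg None))%g; last by exists u.
  by rewrite permM tpermR.
have XE : (al, sg, S) = F (s, a, sg None, [set x | Some x \in S]).
  rewrite /F /insert -sE -mulgA tperm2 mulg1 aE; congr (_, _, _).
  apply/setP=> -[x|]; first by rewrite mem_imset // inE.
  by rewrite (negbTE S0); apply/esym/negbTE/imsetP => -[].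
exists (s, a, sg None, [set x | Some x \in S]) => //.
by rewrite [_ \in covered_stat Q]FE -XE m andbT (empty s _ [set x | Some x \in S] a) // -XE.
Qed.

Lemma card_covered_npairs Q n : #|T| = n.*2 ->
  n.+1`! * #|covered_stat Q| = #|covered_stat (fun _ _ => true)| * npairs Q n.+1.
Proof. by move=> Tn; rewrite !card_covered card_marked // card_option Tn. Qed.

End Covered.

(** * Isomorphism classes of rooted structures *)

Section Classes.
Variables (T U : finType) (K : eqType) (act : {perm T} -> U -> U) (P : pred U) (R : rel U).
Variables (frame : U -> K) (k0 : K).
Hypothesis RE : forall x y, R x y = [exists phi, act phi x == y].
Hypothesis act1 : forall x, act 1%g x = x.
Hypothesis actM : forall phi psi x, act psi (act phi x) = act (phi * psi)%g x.
Hypothesis actP : forall phi x, P x -> P (act phi x).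
Hypothesis frame_free : forall phi x, P x -> frame (act phi x) = frame x -> phi = 1%g.
Hypothesis frame_trans : forall x, P x -> exists phi, frame (act phi x) = k0.

Let class x := [set y | P y && R x y].

Let classE x : P x -> class x = [set act phi x | phi : {perm T}].
Proof.
move=> Px; apply/setP=> y; rewrite inE RE; apply/andP/imsetP => [[_ /existsP[phi /eqP <-]]|].
  by exists phi.
by move=> [phi _ ->]; split; [exact: actP|apply/existsP; exists phi].
Qed.

Let class_refl x : P x -> x \in class x.
Proof. by move=> Px; rewrite classE //; apply/imsetP; exists 1%g; rewrite ?act1. Qed.

Let class_eq x phi : P x -> class (act phi x) = class x.
Proof.
move=> Px; rewrite !classE //; last exact: actP.
apply/setP=> y; apply/imsetP/imsetP => -[psi _ ->].
  by exists (phi * psi)%g; rewrite // actM.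
by exists (phi^-1 * psi)%g; rewrite // actM mulgA mulgV mul1g.
Qed.

(** Each class contains exactly one object with frame [k0]: [frame_trans] provides it and
    [frame_free] makes it unique. *)
Lemma nclasses_frame : nclasses P R = #|[set x | P x && (frame x == k0)]|.
Proof.
rewrite /nclasses -(card_in_imset (f := class)) => [|x y]; last first.
  rewrite !inE => /andP[Px /eqP fx] /andP[Py /eqP fy] E.
  have : y \in class x by rewrite E class_refl.
  rewrite classE // => /imsetP[phi _ yE].
  have := frame_free (phi := phi) Px; rewrite -yE fx fy => /(_ erefl) phi1.
  by rewrite yE phi1 act1.
congr #|pred_of_set _|; apply/setP=> C; apply/imsetP/imsetP => -[x].
  rewrite inE => Px ->; have [phi phiE] := frame_trans Px.
  by exists (act phi x); rewrite ?inE ?actP ?phiE ?eqxx // class_eq.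
by rewrite inE => /andP[Px _] ->; exists x; rewrite ?inE.
Qed.

(** Relabellings act freely on the objects, so every class is a regular orbit. *)
Lemma card_nclasses : #|P| = nclasses P R * #|T|`!.
Proof.
have Req : {in [set x | P x] & &, equivalence_rel R}.
  have class_in x y : P y -> (R x y) = (y \in class x) by rewrite inE => ->.
  move=> x y z; rewrite !inE => Px Py Pz; split; first by rewrite class_in ?class_refl.
  rewrite class_in // classE // => /imsetP[phi _ yE].
  by rewrite !class_in // yE class_eq.
have -> : nclasses P R = #|equivalence_partition R [set x | P x]|.
  congr #|pred_of_set _|; apply: eq_imset => x; apply/setP=> y.
  by rewrite !inE.
rewrite -cardsE; apply: card_uniform_partition (equivalence_partitionP Req).
move=> _ /imsetP[x Px ->]; rewrite inE in Px.
have -> : [set y in [set x | P x] | R x y] = class x by apply/setP=> y; rewrite !inE.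
rewrite classE // card_imset => [|phi psi E].
  by have := card_perm [set: T]; rewrite cardsT => <-; apply/esym/eq_card => p; apply/subsetP.
apply/eqP; rewrite eq_sym eq_mulgV1; apply/eqP/(frame_free (x := x)) => //.
by rewrite -actM -E actM mulgV act1.
Qed.

End Classes.

Lemma card_porbitsJ (T : finType) (s phi : {perm T}) :
  #|porbits (s ^ phi)%g| = #|porbits s|.
Proof.
apply: (@card_porbits_intertwine _ _ _ _ phi).
  by exists phi^-1%g => x; rewrite ?permK ?permKV.
by move=> x; rewrite permJ.
Qed.

Lemma perm_conjP (T : finType) (s s' phi : {perm T}) :
  reflect (forall x, phi (s x) = s' (phi x)) ((s ^ phi)%g == s').
Proof.
apply: (iffP eqP) => [<- x|H]; first by rewrite permJ.
by apply/permP=> x; rewrite -[x](permKV phi) permJ H.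
Qed.

(** Points at equal distance from [x] and [x'] along the two cycles are matched; both cycles exhaust
    [T], so their lengths agree. *)
Lemma unicyclic_conj (T : finType) (s s' : {perm T}) x x' : unicyclic s -> unicyclic s' ->
  exists phi : {perm T}, phi x = x' /\ (s ^ phi)%g = s'.
Proof.
move=> /unicyclicP us /unicyclicP us'.
have conn y : fconnect s x y by rewrite -porbit_fconnect.
have conn' y : fconnect s' x' y by rewrite -porbit_fconnect.
have ord : fingraph.order s x = fingraph.order s' x'.
  by apply: eq_card => y; transitivity true; [exact: conn|exact/esym/conn'].
pose f y := iter (findex s x y) s' x'.
have f_inj : injective f.
  move=> y z E; rewrite -(iter_findex (conn y)) -(iter_findex (conn z)).
  have fi u : findex s' x' (f u) = findex s x u by rewrite findex_iter // -ord findex_max.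
  by rewrite -fi E fi.
exists (perm f_inj); split; first by rewrite permE /f findex0.
apply/eqP/perm_conjP=> y; rewrite !permE /f.
case: (eqVneq (s y) x) => [sy|ny]; last by rewrite findex_step.
by rewrite sy findex0 -iterS findex_last // ord iter_order //; exact: perm_inj.
Qed.

(** * Relabellings, and rigidity given a long cycle and a root *)

Section Frames.
Variable T : finType.
Implicit Types (s a t phi : {perm T}) (r : option T).

Definition rooted r := (r == None) == (#|T| == 0).

Lemma rooted_None : rooted None -> #|T| = 0.
Proof. by rewrite /rooted eqxx eq_sym eqb_id => /eqP. Qed.

Lemma rooted_Some x : rooted (Some x).
Proof. by rewrite /rooted /= eq_sym eqbF_neg -lt0n; apply/card_gt0P; exists x. Qed.

(** A relabelling that commutes with a long cycle is determined by the image of one point, here the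
    root. *)
Lemma frame_free s r phi : unicyclic s -> rooted r -> (s ^ phi)%g = s -> omap phi r = r ->
  phi = 1%g.
Proof.
move=> /unicyclicP us; case: r => [x _ /eqP/perm_conjP sphi [fx]|/rooted_None/card0_eq T0 _ _].
  apply/permP=> y; rewrite perm1; have /porbit_iterP[i <-] := us x y.
  by elim: i => //= i IH; rewrite sphi IH.
by apply/permP=> y; have := T0 y.
Qed.

Lemma frame_trans s r s' r' : unicyclic s -> rooted r -> unicyclic s' -> rooted r' ->
  exists phi, ((s ^ phi)%g, omap phi r) = (s', r').
Proof.
move=> us rr us'; case: r rr => [x _|/rooted_None T0]; case: r' => [x'|].
- by have [phi [<- <-]] := unicyclic_conj x x' us us'; exists phi.
- by move/rooted_None/card0_eq/(_ x).
- by have := card0_eq T0 x'.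
by move=> _; exists 1%g; congr (_, _); apply/permP => y; have := card0_eq T0 y.
Qed.

Lemma rooted_omap phi r : rooted (omap phi r) = rooted r.
Proof. by case: r. Qed.

Lemma fpfreeJ a phi : fpfree (a ^ phi)%g = fpfree a.
Proof.
apply/fpfreeP/fpfreeP => -[aK a_fix]; split=> x.
- by have := aK (phi x); rewrite !permJ => /perm_inj.
- by have := a_fix (phi x); rewrite permJ (inj_eq perm_inj).
- by rewrite -[x](permKV phi) !permJ aK.
- by rewrite -[x](permKV phi) permJ (inj_eq perm_inj).
Qed.

Lemma iso_mapE s a r s' a' r' phi :
  iso_map s a r s' a' r' phi = (((s ^ phi)%g, (a ^ phi)%g, omap phi r) == (s', a', r')).
Proof.
by rewrite !xpair_eqE /iso_map -andbA; congr [&& _, _ & _];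
  apply/forallP/perm_conjP => H x; apply/eqP.
Qed.

Definition relabel_map phi (M : MapT T) : MapT T :=
  let: (s, a, r) := M in ((s ^ phi)%g, (a ^ phi)%g, omap phi r).

Lemma relabel_map1 M : relabel_map 1%g M = M.
Proof.
by case: M => -[s a] r; rewrite /= !conjg1; case: r => //= x; rewrite perm1.
Qed.

Lemma relabel_mapM phi psi M : relabel_map psi (relabel_map phi M) = relabel_map (phi * psi)%g M.
Proof.
by case: M => -[s a] r; rewrite /= !conjgM; case: r => //= x; rewrite permM.
Qed.

Lemma map_relE M M' : map_rel M M' = [exists phi, relabel_map phi M == M'].
Proof.
case: M M' => [[s a] r] [[s' a'] r'].
by apply: eq_existsb => phi; rewrite iso_mapE.
Qed.

Definition relabel_cov phi (C : CovT T) : CovT T :=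
  let: (M, B) := C in (relabel_map phi M, phi @: B).

Lemma relabel_cov1 C : relabel_cov 1%g C = C.
Proof.
case: C => M B; rewrite /= relabel_map1; congr (_, _); rewrite -[RHS]imset_id.
by apply: eq_imset => x; rewrite perm1.
Qed.

Lemma relabel_covM phi psi C : relabel_cov psi (relabel_cov phi C) = relabel_cov (phi * psi)%g C.
Proof.
case: C => M B; rewrite /= relabel_mapM -imset_comp; congr (_, _).
by apply: eq_imset => x /=; rewrite permM.
Qed.

Lemma cov_relE C C' : cov_rel C C' = [exists phi, relabel_cov phi C == C'].
Proof.
case: C C' => [[[s a] r] B] [[[s' a'] r'] B'].
by apply: eq_existsb => phi; rewrite iso_mapE -xpair_eqE.
Qed.

Lemma stableJ a phi (B : {set T}) : stable (a ^ phi)%g (phi @: B) = stable a B.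
Proof.
apply/stableP/stableP => H x.
  by have := H (phi x); rewrite permJ !(mem_imset _ _ perm_inj).
by rewrite -[x](permKV phi) permJ !(mem_imset _ _ perm_inj).
Qed.

Lemma tourJ s a phi (B : {set T}) : stable a B ->
  tour (s ^ phi)%g (a ^ phi)%g (phi @: B) = (tour s a B ^ phi)%g.
Proof.
move=> aB; apply/permP=> x; rewrite -[x](permKV phi) permJ !tourE ?stableJ //.
by rewrite (mem_imset _ _ perm_inj) !permJ; case: ifP => _; rewrite ?permJ.
Qed.

Lemma covered_statE Q s a r (B : {set T}) : covered_stat Q (s, a, r, B) =
  [&& fpfree a, rooted r, stable a B, unicyclic (tour s a B) &
   Q (maxn 1 #|porbits s|) (maxn 1 #|porbits (a * s)%g|)].
Proof. by rewrite /= andbA is_map_coverE -!andbA. Qed.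

Lemma covered_statJ Q phi (C : CovT T) : covered_stat Q (relabel_cov phi C) = covered_stat Q C.
Proof.
case: C => [[[s a] r] B]; rewrite /relabel_cov /relabel_map.
rewrite !covered_statE fpfreeJ rooted_omap stableJ.
case: (boolP (stable a B)) => aB; last by rewrite !andbF.
by rewrite tourJ // -conjMg /unicyclic !card_porbitsJ.
Qed.

Definition cov_frame (C : CovT T) := let: (s, a, r, B) := C in (tour s a B, r).

Lemma cov_frame_free Q phi C : covered_stat Q C ->
  cov_frame (relabel_cov phi C) = cov_frame C -> phi = 1%g.
Proof.
case: C => [[[s a] r] B]; rewrite covered_statE => /and5P[_ rr aB ut _] /=.
by rewrite tourJ // => -[]; exact: frame_free.
Qed.

Lemma cov_frame_trans Q t (r0 : option T) (C : CovT T) :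
  unicyclic t -> rooted r0 -> covered_stat Q C ->
  exists phi, cov_frame (relabel_cov phi C) = (t, r0).
Proof.
move=> ut r0r; case: C => [[[s a] r] B]; rewrite covered_statE => /and5P[_ rr aB uB _].
have [phi E] := frame_trans uB rr ut r0r.
by exists phi; rewrite /= tourJ.
Qed.

Lemma card_covered_nclasses Q :
  #|covered_stat (T := T) Q| = nclasses (covered_stat Q) (@cov_rel T) * #|T|`!.
Proof.
apply: (@card_nclasses _ _ _ relabel_cov _ _ cov_frame).
- exact: cov_relE.
- exact: relabel_cov1.
- exact: relabel_covM.
- by move=> phi C; rewrite covered_statJ.
- exact: cov_frame_free.
Qed.

Lemma nclasses_covered Q t (r0 : option T) : unicyclic t -> rooted r0 ->
  nclasses (covered_stat (T := T) Q) (@cov_rel T) =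
  #|[set C | covered_stat Q C && (cov_frame C == (t, r0))]|.
Proof.
move=> ut rr; apply: (@nclasses_frame _ _ _ relabel_cov).
- exact: cov_relE.
- exact: relabel_cov1.
- exact: relabel_covM.
- by move=> phi C; rewrite covered_statJ.
- exact: cov_frame_free.
- by move=> C; apply: cov_frame_trans.
Qed.

End Frames.

(** * Counting covered maps *)

Section Swaps.
Variable T : finType.
Implicit Types (a mu : {perm T}) (I : {set T}).

Definition swaps a I := fpfree a && [forall x, (a x \in I) == (x \notin I)].

Lemma swapsP a I :
  reflect (involutive a /\ forall x, (a x \in I) = (x \notin I)) (swaps a I).
Proof.
apply: (iffP andP) => [[/fpfreeP[aK _] /forallP H]|[aK H]].
  by split=> // x; exact/eqP.
split; last by apply/forallP=> x; rewrite H.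
by apply/fpfreeP; split=> // x; apply/eqP=> E; have := H x; rewrite E; case: (x \in I).
Qed.

Lemma swaps_card a I : swaps a I -> #|T| = #|I|.*2.
Proof.
move=> /swapsP[aK aI]; rewrite -(cardsC I).
have -> : #|~: I| = #|I|; last by rewrite addnn.
rewrite -(card_imset I (@perm_inj _ a)); apply: eq_card => x; rewrite inE.
apply/idP/imsetP => [xI|[y yI ->]]; last by rewrite aI negbK.
by exists (a x); rewrite ?aK // aI.
Qed.

(** The k-th element of [I] is matched with the k-th element of its complement. *)
Lemma swaps_exists I : #|T| = #|I|.*2 -> exists a, swaps a I.
Proof.
move=> TI; have CI : #|~: I| = #|I| by have := cardsC I; lia.
pose f x := if x \in I then nth x (enum (~: I)) (index x (enum I))
  else nth x (enum I) (index x (enum (~: I))).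
have ltI x : x \in I -> index x (enum I) < size (enum (~: I)).
  by move=> xI; rewrite -cardE CI cardE index_mem mem_enum.
have ltC x : x \notin I -> index x (enum (~: I)) < size (enum I).
  by move=> xI; rewrite -cardE -CI cardE index_mem mem_enum inE.
have fI x : (f x \in I) = (x \notin I).
  rewrite /f; case: ifP => [xI|/negbT xI]; last by rewrite -mem_enum mem_nth ?ltC.
  by apply/negbTE; rewrite -in_setC -mem_enum mem_nth ?ltI.
have fK : involutive f.
  move=> x; case: (boolP (x \in I)) => xI.
    by rewrite {1}/f fI xI /f xI index_uniq ?enum_uniq ?ltI // nth_index ?mem_enum.
  by rewrite {1}/f fI xI /f (negbTE xI) index_uniq ?enum_uniq ?ltC // nth_index ?mem_enum ?inE.
exists (perm (inv_inj fK)); apply/swapsP; split=> x; rewrite !permE //.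
Qed.

(** Such matchings are the conjugates of a fixed one [mu] by the permutations [p] of [I], each
    obtained once: on [I], [a (p x) = mu x] forces [p x = a (mu x)]. *)
Lemma card_swaps I : #|T| = #|I|.*2 -> #|[set a | swaps a I]| = #|I|`!.
Proof.
move=> /swaps_exists[mu /swapsP[muK muI]].
have outI p x : perm_on I p -> x \notin I -> p x = x by move=> pI; exact: out_perm.
rewrite -card_perm -[RHS](card_in_imset (f := fun p => (mu ^ p)%g)) => [|p q pI qI E].
  apply: eq_card => a; rewrite inE; apply/swapsP/imsetP => [[aK aI]|[p pI ->]].
    have nI : (mu * a)%g \in 'N(I | 'P)%g.
      by apply/astabsP=> x; rewrite /= /aperm permM aI muI negbK.
    exists (restr_perm I (mu * a)%g); first exact: restr_perm_on.
    apply/esym/eqP/perm_conjP => x; case: (boolP (x \in I)) => xI.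
      rewrite (outI _ _ (restr_perm_on _ _)) ?muI ?xI //.
      by rewrite restr_permE // permM aK.
    rewrite [in RHS](outI _ _ (restr_perm_on _ _)) //.
    by rewrite restr_permE ?muI // permM muK.
  have permI x : (p x \in I) = (x \in I) by exact: perm_closed.
  split=> x; rewrite -[x](permKV p); first by rewrite !permJ muK.
  by rewrite permJ !permI muI.
have H r x : perm_on I r -> x \in I -> (mu ^ r)%g (r x) = mu x.
  by move=> rI xI; rewrite permJ (outI r) // muI xI.
apply/permP=> x; case: (boolP (x \in I)) => xI; last by rewrite !outI.
by apply: (@perm_inj _ (mu ^ p)%g); rewrite {2}E !H.
Qed.

Lemma exists_swapped a : fpfree a -> exists I, swaps a I.
Proof.
move=> /fpfreeP[aK a_fix]; exists [set x | enum_rank x < enum_rank (a x)].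
apply/swapsP; split=> // x; rewrite !inE aK -leqNgt ltn_neqAle.
by rewrite (inj_eq val_inj) (inj_eq enum_rank_inj) a_fix.
Qed.

(** Symmetric difference with a fixed set [I0] holding one half of each edge is the bijection. *)
Lemma card_stable_swaps a : fpfree a -> #|[set B | stable a B]| = #|[set I | swaps a I]|.
Proof.
move=> fa; have [I0 /swapsP[aK aI0]] := exists_swapped fa.
pose D (B : {set T}) := [set x | (x \in I0) (+) (x \in B)].
have DK : involutive D by move=> B; apply/setP=> x; rewrite !inE addKb.
rewrite -(card_imset _ (inv_inj DK)); apply: eq_card => I; rewrite inE.
apply/imsetP/swapsP => [[B]|[_ aI]].
  rewrite inE => /stableP aB ->; split=> // x.
  by rewrite !inE aI0 aB addNb.
exists (D I); rewrite ?DK // inE; apply/stableP=> x.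
by rewrite !inE aI0 aI; case: (x \in I0); case: (x \in I).
Qed.

(** The fixed tour and the pair of [a] and [B] determine the vertex permutation. Stable sets [B] are
    traded for sets [I] with one half of each edge; then [I] is chosen first, and a matching of [I]
    with its complement second. *)
Lemma card_covered_fiber (t : {perm T}) r0 n : #|T| = n.*2 -> unicyclic t -> rooted r0 ->
  #|[set C : CovT T | covered_stat (fun _ _ => true) C && (cov_frame C == (t, r0))]|
  = 'C(n.*2, n) * n`!.
Proof.
move=> Tn ut rr.
pose F (x : {perm T} * {set T}) : CovT T := (((restr_perm x.2 x.1)^-1 * t)%g, x.1, r0, x.2).
have F_inj : injective F by move=> [a B] [a' B'] [_ -> ->].
transitivity #|[set x : {perm T} * {set T} | fpfree x.1 && stable x.1 x.2]|.
  rewrite -(card_imset _ F_inj); apply: eq_card => -[[[s a] r] B]; rewrite inE.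
  apply/andP/imsetP => [[]|[[a' B']]].
    rewrite covered_statE => /and5P[fa _ aB _ _] /eqP[tE ->].
    by exists (a, B); rewrite ?inE /= ?fa // /F /= -tE /tour mulKg.
  rewrite inE /= => /andP[fa aB] [-> -> -> ->].
  by rewrite andbA is_map_coverE /tour mulKVg fa aB ut eqxx !andbT; split.
transitivity (\sum_(a : {perm T}) \sum_(B : {set T}) (fpfree a && stable a B : nat)).
  by rewrite pair_bigA /= sum_bool.
transitivity (\sum_(a : {perm T}) \sum_(I : {set T}) (swaps a I : nat)).
  apply: eq_bigr => a _; rewrite !sum_bool; case: (boolP (fpfree a)) => fa /=.
    exact: card_stable_swaps.
  by rewrite !eq_card0 // => I; rewrite !inE // /swaps (negbTE fa).
rewrite exchange_big /= -{1}Tn -card_draws -sum_nat_const [RHS]big_mkcond /=.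
apply: eq_bigr => I _; rewrite sum_bool inE; case: eqP => [In|nI].
  by rewrite card_swaps ?In.
apply: eq_card0 => a; rewrite inE; apply/negP => /swaps_card.
by rewrite Tn => /double_inj E; apply: nI.
Qed.

(** The labelled count [card_covered_npairs] is divided by the class size on both sides; the fiber
    count gives the total number of classes, and the common factor [n!] cancels. *)
Lemma nclasses_covered_npairs Q (t : {perm T}) (r0 : option T) n :
  #|T| = n.*2 -> unicyclic t -> rooted r0 ->
  n.+1 * nclasses (covered_stat (T := T) Q) (@cov_rel T) = 'C(n.*2, n) * npairs Q n.+1.
Proof.
move=> Tn ut rr; have := card_covered_npairs Q Tn.
rewrite !card_covered_nclasses.
rewrite [nclasses (covered_stat (fun _ _ => true)) _](nclasses_covered _ ut rr).
rewrite (card_covered_fiber Tn ut rr) factS.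
have f1 := fact_gt0 n; have f2 := fact_gt0 #|T|.
set A := nclasses _ _; set X := npairs _ _; set b := 'C(_, _); move=> E.
apply/eqP; rewrite -(eqn_pmul2l f1) -(eqn_pmul2r f2); apply/eqP.
by nia.
Qed.

End Swaps.

(** * Bipartite unicellular maps *)

Definition norbits_in (T : finType) (s : {perm T}) (c : pred T) :=
  #|[set O in porbits s | [exists x in O, c x]]|.

Lemma eq_norbits_in (T : finType) (s : {perm T}) (c c' : pred T) :
  c =1 c' -> norbits_in s c = norbits_in s c'.
Proof.
move=> E; apply: eq_card => O; rewrite !inE; congr andb.
by apply: eq_existsb => x; rewrite E.
Qed.

Section Bipartite.
Variable T : finType.
Implicit Types (s a t phi : {perm T}) (r : option T) (c : {ffun T -> bool}).

Definition bip_stat (Q : nat -> nat -> bool) : pred (MapT T) := fun M =>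
  let: (s, a, r) := M in
  [&& is_map s a r, nfaces s a == 1 &
      [exists c : {ffun T -> bool}, [&& proper_col s a c,
        (if r is Some x0 then c x0 else true) &
        Q (norbits_in s c) (norbits_in s (fun x => ~~ c x))]]].

(** Having one face already makes the map connected. *)
Lemma is_map_unicellularE s a r : is_map s a r && (nfaces s a == 1) =
  [&& fpfree a, rooted r & unicyclic (a * s)%g].
Proof.
have -> : (nfaces s a == 1) = unicyclic (a * s)%g.
  by rewrite /nfaces /unicyclic eqn_leq geq_max leq_max /= andbT.
rewrite /is_map -/(fpfree a) -/(rooted r).
case: (boolP (unicyclic _)) => uas; last by rewrite !andbF.
rewrite !andbT; case: (fpfree a) => //=; apply: andb_idl => _.
apply/forallP=> x; apply/forallP=> y; apply: unicyclic_connect uas _ x y => z.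
by apply: (@connect_trans _ _ (a z)); apply: connect1; rewrite /step_rel ?permM eqxx ?orbT.
Qed.

Lemma proper_colP s a c :
  reflect ((forall x, c (s x) = c x) /\ forall x, c (a x) = ~~ c x) (proper_col s a c).
Proof.
apply: (iffP andP) => [[/forallP H /forallP K]|[H K]].
  split=> x; first exact/eqP.
  by have := K x; case: (c x); case: (c (a x)).
by split; apply/forallP=> x; rewrite ?H // K; case: (c x).
Qed.

Lemma norbits_inJ s phi (d : pred T) :
  norbits_in (s ^ phi)%g (d \o phi^-1%g) = norbits_in s d.
Proof.
have pJ x : porbit (s ^ phi)%g (phi x) = phi @: porbit s x.
  apply/setP=> y; apply/porbit_iterP/imsetP => [[i <-]|[z /porbit_iterP[i <-] ->]].
    exists (iter i s x); first exact: mem_porbit_iter.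
    by elim: i => //= i ->; rewrite permJ.
  by exists i; elim: i => //= i ->; rewrite permJ.
rewrite /norbits_in -[RHS](card_imset _ (imset_inj (@perm_inj _ phi))).
apply: eq_card => O; rewrite inE.
apply/andP/imsetP => [[/imsetP[x _ ->] /existsP[y /andP[xy dy]]]|[O']].
  rewrite -[x](permKV phi) pJ in xy *.
  exists (porbit s (phi^-1%g x)) => //; rewrite inE imset_f //=.
  apply/existsP; exists (phi^-1%g y); rewrite [d _]dy andbT.
  by case/imsetP: xy => z xz ->; rewrite permK.
rewrite inE => /andP[/imsetP[x _ ->] /existsP[y /andP[xy dy]] ->].
rewrite -pJ imset_f; split=> //; apply/existsP; exists (phi y).
by rewrite pJ imset_f //= permK.
Qed.

Lemma bip_statE Q s a r : bip_stat Q (s, a, r) =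
  [&& fpfree a, rooted r, unicyclic (a * s)%g &
      [exists c : {ffun T -> bool}, [&& proper_col s a c,
        (if r is Some x0 then c x0 else true) &
        Q (norbits_in s c) (norbits_in s (fun x => ~~ c x))]]].
Proof. by rewrite /= andbA is_map_unicellularE -!andbA. Qed.

Lemma bip_statJ Q phi M : bip_stat Q M -> bip_stat Q (relabel_map phi M).
Proof.
case: M => [[s a] r]; rewrite /relabel_map !bip_statE -conjMg fpfreeJ rooted_omap /unicyclic.
rewrite card_porbitsJ => /and4P[-> -> -> /=] /existsP[c /and3P[/proper_colP[cs ca] cr Qc]].
pose c' := [ffun x => c (phi^-1%g x)].
apply/existsP; exists c'; apply/and3P; split.
- apply/proper_colP; split=> x; rewrite -[x](permKV phi) permJ !ffunE !permK //.
- by case: r cr => //= x; rewrite ffunE permK.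
- rewrite (_ : norbits_in _ c' = norbits_in s c); last first.
    by rewrite -(norbits_inJ s phi c); apply: eq_norbits_in => x; rewrite ffunE.
  rewrite (_ : norbits_in _ (fun x => ~~ c' x) = norbits_in s (fun x => ~~ c x)) //.
  rewrite -(norbits_inJ s phi (fun x => ~~ c x)); apply: eq_norbits_in => x.
  by rewrite /= ffunE.
Qed.

(** The face permutation plays here the part that the tour plays for covered maps. *)
Definition map_frame (M : MapT T) := let: (s, a, r) := M in ((a * s)%g, r).

Lemma nclasses_bip Q t r0 : unicyclic t -> rooted r0 ->
  nclasses (bip_stat Q) (@map_rel T) =
  #|[set M | bip_stat Q M && (map_frame M == (t, r0))]|.
Proof.
move=> ut rr; have := @nclasses_frame _ _ _ (@relabel_map T) (bip_stat Q) (@map_rel T) map_frame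
  (t, r0); apply.
- exact: map_relE.
- exact: relabel_map1.
- exact: relabel_mapM.
- by move=> phi M; exact: bip_statJ.
- move=> phi [[s a] r]; rewrite bip_statE => /and4P[_ r1 ut1 _] /=.
  by rewrite -conjMg => -[]; exact: frame_free.
- move=> [[s a] r]; rewrite bip_statE => /and4P[_ r1 ut1 _].
  have [phi E] := frame_trans ut1 r1 ut rr.
  by exists phi; rewrite /= -conjMg.
Qed.

End Bipartite.

Lemma iter_rot_ord m (x : 'I_m) (lt0 : 0 < m) : iter x (rot_ord m) (Ordinal lt0) = x.
Proof.
suff H i (lt : i < m) : iter i (rot_ord m) (Ordinal lt0) = Ordinal lt.
  by rewrite (H x (ltn_ord x)); apply: val_inj.
elim: i lt => [|i IH] lt; first exact: val_inj.
by rewrite iterS (IH (ltnW lt)) permE; apply: val_inj; rewrite /= modn_small.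
Qed.

Lemma unicyclic_rot_ord m : unicyclic (rot_ord m).
Proof.
apply/unicyclicP=> x y; have lt0 : 0 < m by apply: leq_ltn_trans (ltn_ord x).
have H z : z \in porbit (rot_ord m) (Ordinal lt0).
  by rewrite -[X in X \in _](iter_rot_ord z lt0) mem_porbit_iter.
by have := H x; rewrite -eq_porbit_mem => /eqP ->.
Qed.

(** * Bipartite maps whose face is the standard long cycle *)

Section BipartiteFiber.
Variables (m : nat) (lt0 : 0 < m.*2).
Let I2 := 'I_(m.*2).
Let t : {perm I2} := rot_ord m.*2.
Let r0 : option I2 := Some (Ordinal lt0).
Let W := [set x : I2 | ~~ odd x].

(** The closing step also changes parity: it leads from the last position, which is odd, to 0. *)
Let tW x : (t x \in W) = (x \notin W).
Proof.
rewrite !inE permE /= negbK; have := ltn_ord x.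
rewrite leq_eqVlt => /predU1P[E|lt]; last by rewrite modn_small //= negbK.
by rewrite E modnn /=; have := congr1 odd E; rewrite odd_double /=; case: odd.
Qed.

(** With the frame fixed, [a] determines the vertex permutation [a * t]. Colours alternate along the
    face starting from the white root, so the colouring is forced: white is [W]. *)
Lemma card_bip_fiber Q :
  #|[set M | bip_stat Q M && (map_frame M == (t, r0))]| =
  #|[set a | swaps a W && Q (norbits_in (a * t)%g (fun x => x \in W))
                            (norbits_in (a * t)%g (fun x => x \in ~: W))]|.
Proof.
pose F (a : {perm I2}) : MapT I2 := ((a * t)%g, a, r0).
have F_inj : injective F by move=> a b [].
have cW (c : {ffun I2 -> bool}) s : c =1 (fun x => x \in W) ->
    Q (norbits_in s c) (norbits_in s (fun x => ~~ c x)) =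
    Q (norbits_in s (fun x => x \in W)) (norbits_in s (fun x => x \in ~: W)).
  move=> E; rewrite (eq_norbits_in s E); congr (Q _ _); apply: eq_norbits_in => x.
  by rewrite inE E.
rewrite -[RHS](card_imset _ F_inj); apply: eq_card => -[[s a] r]; rewrite inE.
apply/andP/imsetP => [[]|[b]].
  rewrite bip_statE => /and4P[fa _ _ /existsP[c /and3P[/proper_colP[cs ca] cr Qc]]].
  move=> /eqP[tE rE]; have [aK _] := fpfreeP _ fa.
  have sE : s = (a * t)%g by rewrite -tE mulgA; apply/permP=> x; rewrite !permM aK.
  rewrite rE /= in cr.
  have ct x : c (t x) = ~~ c x by rewrite -tE permM cs ca.
  have cWE : c =1 (fun x => x \in W).
    move=> x; rewrite inE -{1}(iter_rot_ord x lt0).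
    by elim: (x : nat) => //= i IH; rewrite ct IH.
  exists a; last by rewrite /F -sE rE.
  rewrite inE -sE -(cW c s cWE) Qc andbT; apply/swapsP; split=> // x.
  by have := ca x; rewrite !cWE.
rewrite inE => /andP[/swapsP[bK bW] Qb] [-> -> ->].
have fb : fpfree b.
  by apply/fpfreeP; split=> // x; apply/eqP=> E; have := bW x; rewrite E; case: (x \in W).
have bt : (b * (b * t))%g = t by apply/permP=> x; rewrite !permM bK.
split; last by rewrite /= bt.
rewrite bip_statE fb rooted_Some bt unicyclic_rot_ord /=.
pose c := [ffun x => x \in W].
have cE : c =1 (fun x => x \in W) by move=> x; rewrite ffunE.
apply/existsP; exists c; rewrite (cW c _ cE) Qb !ffunE inE andbT /=; apply/andP; split=> //.
by apply/proper_colP; split=> x; rewrite !ffunE ?permM ?tW bW // negbK.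
Qed.

Let e (i : 'I_m) : I2 := Ordinal (etrans (ltn_double i m) (ltn_ord i)).

Let e_inj : injective e.
Proof. by move=> i j [] /double_inj; exact: val_inj. Qed.

Let eW x : (x \in W) = (x \in codom e).
Proof.
rewrite inE; apply/idP/codomP => [ex|[i ->]]; last by rewrite /= odd_double.
have xE : x./2.*2 = x by rewrite even_halfK.
have lt : x./2 < m by rewrite -ltn_double xE.
by exists (Ordinal lt); apply: val_inj; rewrite /= xE.
Qed.

Let e_in i : e i \in W. Proof. by rewrite eW codom_f. Qed.

Let erot i : e (rot_ord m i) = t (t (e i)).
Proof.
apply: val_inj; rewrite !permE /=; have := ltn_ord i.
rewrite leq_eqVlt => /predU1P[E|lt].
  by rewrite E modnn /= (@modn_small i.*2.+1) -?doubleS ?E ?modnn // -E doubleS.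
rewrite modn_small // (@modn_small i.*2.+1); last by have := lt; rewrite -ltn_double; lia.
by rewrite -doubleS modn_small // ltn_double.
Qed.

Let white_ex a : swaps a W -> exists v : {perm 'I_m}, forall i, e (v i) = t (a (e i)).
Proof.
move=> /swapsP[_ aW].
have nW : (a * t)%g \in 'N(W | 'P)%g.
  by apply/astabsP=> x; rewrite /= /aperm permM tW aW negbK.
have [|v vE] := @perm_on_ext _ _ e e_inj (restr_perm W (a * t)%g).
  rewrite (_ : [set x in codom e] = W); first exact: restr_perm_on.
  by apply/setP=> x; rewrite inE eW.
by exists v => i; rewrite -(extE e_inj) -vE restr_permE // permM.
Qed.

(** The vertex permutation on the white half-edges, in the coordinates [e]. The default is reached
    only when [a] does not swap [W] with its complement. *)
Let white (a : {perm I2}) : {perm 'I_m} :=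
  odflt 1%g [pick v : {perm 'I_m} | [forall i, e (v i) == t (a (e i))]].

Let whiteE a i : swaps a W -> e (white a i) = t (a (e i)).
Proof.
move=> /white_ex[v vE]; rewrite /white; case: pickP => [u /forallP/(_ i)/eqP //|/(_ v)].
by move/negP; case; apply/forallP=> j; rewrite vE.
Qed.

Let white_inj : {in [set a | swaps a W] &, injective white}.
Proof.
move=> a b; rewrite !inE => sa sb E.
have [aK aW] := swapsP _ _ sa; have [bK bW] := swapsP _ _ sb.
have H x : x \in W -> a x = b x.
  by rewrite eW => /codomP[i ->]; apply: (@perm_inj _ t); rewrite -!whiteE // E.
apply/permP=> x; case: (boolP (x \in W)) => xW; first exact: H.
by apply: (@perm_inj _ b); rewrite bK -H ?aK // aW.
Qed.

Let Wm : #|W| = m.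
Proof.
by rewrite -[RHS]card_ord -(card_codom e_inj); apply: eq_card => x; rewrite eW.
Qed.

(** By counting: [white] is injective on the [m!] matchings. *)
Let white_surj v : exists2 a, swaps a W & white a = v.
Proof.
have : v \in white @: [set a | swaps a W].
  have -> : white @: [set a | swaps a W] = setT.
    apply/eqP; rewrite eqEcard subsetT cardsT card_Sn card_in_imset; last exact: white_inj.
    by rewrite /= (@card_swaps _ W) Wm // card_ord.
  by rewrite inE.
by case/imsetP=> a; rewrite inE => sa ->; exists a.
Qed.

(** Inversion keeps the cycle number; it is inserted so that the same permutation serves for the
    black vertices. *)
Let white_orbits a : swaps a W ->
  norbits_in (a * t)%g (fun x => x \in W) = #|porbits (white a)^-1%g|.
Proof.
move=> sa; have [aK aW] := swapsP _ _ sa; rewrite porbitsV.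
apply: (@card_porbits_return _ _ W _ e) => // i.
by rewrite restr_step ?permM ?whiteE // tW aW e_in.
Qed.

(** Odd positions get the coordinates [a \o e]. There the vertex permutation is [rot_ord m] followed
    by the inverse of [white a], because two steps of [t] make one step of [rot_ord m]. *)
Let black_orbits a : swaps a W ->
  norbits_in (a * t)%g (fun x => x \in ~: W) = #|porbits ((white a)^-1 * rot_ord m)%g|.
Proof.
move=> sa; have [aK aW] := swapsP _ _ sa; rewrite card_porbits_mulC.
apply: (@card_porbits_return _ _ (~: W) _ (a \o e)).
- exact: inj_comp perm_inj e_inj.
- move=> x; rewrite inE; apply/idP/codomP => [xW|[i ->]]; last by rewrite /= aW e_in.
  have : a x \in codom e by rewrite -eW aW.
  by case/codomP=> i E; exists i; rewrite /= -E aK.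
- move=> i; have E : (a * t)%g (a (e i)) = t (e i) by rewrite permM aK.
  have aeW x : x \in W -> a x \in ~: W by rewrite in_setC aW negbK.
  have teW x : x \in W -> t x \in ~: W by rewrite in_setC tW negbK.
  rewrite /= restr_step ?E ?aeW ?teW // permM.
  set j := (white a)^-1%g _.
  have : e (white a j) = t (t (e i)) by rewrite /j permKV erot.
  by rewrite whiteE // => /perm_inj.
Qed.

Lemma card_swaps_npairs Q :
  #|[set a | swaps a W && Q (norbits_in (a * t)%g (fun x => x \in W))
                            (norbits_in (a * t)%g (fun x => x \in ~: W))]| = npairs Q m.
Proof.
rewrite -(card_in_imset (f := fun a => (white a)^-1%g)) => [|a b]; last first.
  rewrite !inE => /andP[sa _] /andP[sb _] /invg_inj; by apply: white_inj; rewrite inE.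
apply: eq_card => u; rewrite inE; apply/imsetP/idP => [[a]|Qu].
  by rewrite inE => /andP[sa Qa] ->; rewrite -white_orbits // -black_orbits.
have [a sa aE] := white_surj u^-1%g.
exists a; last by rewrite aE invgK.
by rewrite inE sa white_orbits // black_orbits // aE invgK.
Qed.

Lemma nclasses_bip_npairs Q : nclasses (bip_stat Q) (@map_rel I2) = npairs Q m.
Proof.
rewrite (nclasses_bip Q (unicyclic_rot_ord m.*2) (rooted_Some (Ordinal lt0))).
by rewrite card_bip_fiber card_swaps_npairs.
Qed.

End BipartiteFiber.

(** * The identities *)

Lemma eq_nclasses (U : finType) (P P' : pred U) (R : rel U) :
  P =1 P' -> nclasses P R = nclasses P' R.
Proof.
move=> E; rewrite /nclasses (_ : [set x | P x] = [set x | P' x]); last first.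
  by apply/setP=> x; rewrite !inE E.
congr #|pred_of_set _|; apply: eq_imset => x; apply/setP=> y.
by rewrite !inE E.
Qed.

(** Each vertex is monochromatic, hence counted in exactly one of the two terms. *)
Lemma norbits_in_col (T : finType) (s a : {perm T}) (c : {ffun T -> bool}) :
  proper_col s a c -> norbits_in s c + norbits_in s (fun x => ~~ c x) = #|porbits s|.
Proof.
move=> /proper_colP[cs _].
have cO x y : y \in porbit s x -> c y = c x.
  by case/porbit_iterP=> i <-; elim: i => //= i; rewrite cs.
pose W := [set O : {set T} | [exists x in O, c x]].
rewrite -(cardsID W (porbits s)); congr (_ + _); apply: eq_card => O; rewrite !inE //.
rewrite andbC; apply: andb_id2r => /imsetP[x _ ->]; rewrite negb_exists.
apply/existsP/forallP => [[y /andP[xy cy]] z|/(_ x)].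
  by rewrite negb_and; case: (boolP (z \in _)) => //= xz; rewrite (cO _ _ xz) -(cO _ _ xy).
by rewrite porbit_id /= => nc; exists x; rewrite porbit_id.
Qed.

Lemma bip_uni_genusE n g : @bip_uni_genus 'I_(n.+1.*2) g =1
  bip_stat (fun w b => w + b + g.*2 == n + 2).
Proof.
move=> [[s a] r]; rewrite /bip_uni_genus /bip_stat.
case: (boolP (is_map s a r)) => //= ms; case: eqP => //= f1.
have v0 : 0 < #|porbits s|.
  by apply/card_gt0P; exists (porbit s ord0); exact: imset_f.
have -> : has_genus s a g = (#|porbits s| + g.*2 == n + 2).
  rewrite /has_genus f1 /nverts (maxn_idPr v0) /nedges card_ord divn2 doubleK.
  by apply/eqP/eqP; lia.
apply/andP/existsP => [[gs /existsP[c pc]]|[c /and3P[pc _ gs]]]; last first.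
  by rewrite -(norbits_in_col pc); split=> //; apply/existsP; exists c.
(* The genus count does not prescribe the colour of the root; exchanging the two colours if
   necessary makes it white. *)
pose b := if r is Some x then c x else true.
pose c' := [ffun x => c x == b].
have pc' : proper_col s a c'.
  have [cs ca] := proper_colP _ _ _ pc; apply/proper_colP.
  by split=> x; rewrite !ffunE ?cs // ca; case: (c x); case: (b).
exists c'; rewrite pc' (norbits_in_col pc') gs andbT /=.
by rewrite /c' /b; case: (r) => // x; rewrite ffunE eqxx.
Qed.

Lemma bip_uni_vfE (T : finType) v f : @bip_uni_vf T v f =1
  bip_stat (fun w b => (w == v) && (b == f)).
Proof. by move=> [[s a] r]. Qed.

Lemma covered_genusE n g : @covered_genus 'I_(n.*2) g =1
  covered_stat (fun v f => v + f + g.*2 == n + 2).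
Proof.
by move=> [[[s a] r] B]; rewrite /= /has_genus /nedges card_ord divn2 doubleK.
Qed.

Lemma covered_vfE (T : finType) v f : @covered_vf T v f =1
  covered_stat (fun v' f' => (v' == v) && (f' == f)).
Proof. by move=> [[[s a] r] B]. Qed.

(** The division in [Cat] is exact because [n.+1 * 'C(n.*2, n.+1) = n * 'C(n.*2, n)]. *)
Lemma mul_Cat n : n.+1 * Cat n = 'C(n.*2, n).
Proof.
suff dv : n.+1 %| 'C(n.*2, n) by rewrite mulnC divnK.
have E := mul_bin_left n.*2 n; rewrite -addnn addnK in E.
suff <- : n.+1 * ('C(n.*2, n) - 'C(n.*2, n.+1)) = 'C(n.*2, n) by exact: dvdn_mulr.
by rewrite mulnBr -addnn E; lia.
Qed.

Lemma nclasses_covered_Cat n Q :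
  nclasses (covered_stat Q) (@cov_rel 'I_(n.*2)) = Cat n * npairs Q n.+1.
Proof.
(* Some frame must be supplied; for [n = 0] there is no half-edge and the root is [None]. *)
have [r rr] : exists r, @rooted 'I_(n.*2) r.
  case: (posnP n) => [->|n0]; first by exists None; rewrite /rooted card_ord.
  by exists (Some (Ordinal (etrans (double_gt0 n) n0))); exact: rooted_Some.
have := nclasses_covered_npairs Q (card_ord n.*2) (unicyclic_rot_ord n.*2) rr.
rewrite -mul_Cat -mulnA; move/eqP; rewrite eqn_pmul2l //; exact/eqP.
Qed.

Unset Implicit Arguments.

Theorem mainTheorem3 (n g v f : nat) :
  0 < v -> 0 < f ->
  Cg g n = Cat n * Bg g n.+1 /\ Cvf v f n = Cat n * Bvf v f n.+1.
Proof.
move=> _ _; rewrite /Cg /Cvf /Bg /Bvf.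
rewrite !(eq_nclasses _ (@covered_genusE _ _), eq_nclasses _ (@covered_vfE _ _ _),
  eq_nclasses _ (@bip_uni_genusE _ _), eq_nclasses _ (@bip_uni_vfE _ _ _)).
by rewrite !nclasses_covered_Cat !nclasses_bip_npairs.
Qed.
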